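(* Let $R$ be a commutative noetherian ring satisfying Serre's condition $(\mathsf{S}_2)$. If the Auslander--Reiten conjecture holds for the local ring $R_{\mathfrak{p}}$ for every prime ideal $\mathfrak{p}$ of $R$ with $\operatorname{ht}\mathfrak{p}\le 1$, then the Auslander--Reiten conjecture holds for $R$. In particular, the Auslander--Reiten conjecture holds for every (commutative noetherian) normal ring.
   Context: A commutative noetherian ring $R$ satisfies $(\mathsf{S}_2)$ if $\operatorname{depth} R_{\mathfrak{p}}\ge\inf\{2,\operatorname{ht}\mathfrak{p}\}$ for all prime ideals $\mathfrak{p}$ of $R$. The Auslander--Reiten conjecture is said to hold for a commutative noetherian ring $A$ if every finitely generated $A$-module $M$ with $\operatorname{Ext}_A^i(M,M\oplus A)=0$ for all $i>0$ is projective. A normal ring is a ring all of whose localizations at prime ideals are integrally closed domains. *)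

(* Defs.v *)
From HB Require Import structures.
From mathcomp Require Import all_boot all_order all_algebra.
From mathcomp Require Import all_classical constructive_ereal.
From mathcomp Require Import ring.

Set Implicit Arguments.
Unset Strict Implicit.
Unset Printing Implicit Defensive.

Import Order.TTheory GRing.Theory Num.Theory.
Local Open Scope classical_set_scope.
Local Open Scope quotient_scope.
Local Open Scope ring_scope.

(** Commutative rings are [comPzRingType]s, so that the zero ring is allowed. *)

Definition is_ideal (R : comPzRingType) (I : set R) : Prop :=
  [/\ I 0, (forall x y, I x -> I y -> I (x + y))
    & (forall a x, I x -> I (a * x))].

Definition span_ideal (R : comPzRingType) (s : seq R) : set R :=
  [set x | exists c : 'I_(size s) -> R, x = \sum_i c i * s`_i].

Definition noetherian (R : comPzRingType) : Prop :=
  forall I : set R, is_ideal I -> exists s : seq R, I = span_ideal s.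

Record prime_ideal (R : comPzRingType) := PrimeIdeal {
  prime_set :> R -> Prop;
  prime_is_ideal : is_ideal prime_set;
  prime_proper : ~ prime_set 1;
  prime_mul : forall x y, prime_set (x * y) -> prime_set x \/ prime_set y
}.

(** The supremum of a set of natural numbers, which is [+oo] when the set is
    unbounded and [-oo] when it is empty. *)
Definition nat_esup (S : set nat) : \bar int :=
  supremum -oo%E [set (n%:Z)%:E%E | n in S].

Lemma le_nat_esup (S : set nat) (n : nat) :
  ((n%:Z)%:E <= nat_esup S)%E <-> exists2 m, S m & (n <= m)%N.
Proof.
rewrite /nat_esup; set T := (X in supremum _ X).
have upT (m : nat) : (forall k, S k -> (k <= m)%N) -> ubound T (m%:Z)%:E%E.
  by move=> h _ [k Sk <-]; rewrite lee_fin lez_nat h.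
have [/eqP T0|T0] := boolP (T == set0).
  rewrite T0 supremum0; split=> // -[m Sm _].
  have : T (m%:Z)%:E%E by exists m.
  by rewrite T0.
have [s0 Ss0] : S !=set0.
  by have /set0P[_ [k Sk _]] := T0; exists k.
have supE y : supremums T y -> supremum -oo%E T = y.
  move=> Ty; rewrite /supremum (negPf T0).
  by case: xgetP => [z _ /is_subset1_supremums|/(_ y)//]; apply.
have [[b bS]|nb] := pselect (exists b, forall k, S k -> (k <= b)%N).
  have ex : exists k, `[< S k >] by exists s0; apply/asboolP.
  have bd k : `[< S k >] -> (k <= b)%N by move/asboolP/bS.
  have [m /asboolP Sm mmax] := ex_maxnP ex bd.
  have {}mmax k : S k -> (k <= m)%N by move=> Sk; apply/mmax/asboolP.
  rewrite (supE (m%:Z)%:E%E); last first.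
    by split; [exact: upT|move=> y; apply; exists m].
  rewrite lee_fin lez_nat; split=> [nm|[k Sk nk]]; first by exists m.
  exact: leq_trans nk (mmax k Sk).
rewrite (supE +oo%E); last first.
  split=> [y _|y uy]; first exact: leey.
  case: y uy => [z| //|] uy.
    exfalso; apply: nb; exists `|z|%N => k Sk.
    have : ((k%:Z)%:E <= z%:E)%E by apply: uy; exists k.
    rewrite lee_fin -lez_nat => kz.
    by apply: le_trans kz _; rewrite abszE ler_norm.
  have : ((s0%:Z)%:E <= -oo :> \bar int)%E by apply: uy; exists s0.
  by [].
split=> _; last by rewrite leey.
apply: contrapT => h; apply: nb; exists n => k Sk; rewrite leqNgt.
by apply/negP => nk; apply: h; exists k => //; apply: ltnW.
Qed.

Definition prime_chain (R : comPzRingType) (p : prime_ideal R) (n : nat)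
    (c : nat -> prime_ideal R) : Prop :=
  (forall i, (i < n)%N -> prime_set (c i) `<` prime_set (c i.+1)) /\
  prime_set (c n) = prime_set p.

Definition height (R : comPzRingType) (p : prime_ideal R) : \bar int :=
  nat_esup [set n | exists c, prime_chain p n c].

Definition regular_sequence (A : comPzRingType) (s : seq A) : Prop :=
  (forall i, (i < size s)%N -> forall y : A,
     span_ideal (take i s) (s`_i * y) -> span_ideal (take i s) y) /\
  ~ span_ideal s 1.

(** For a local ring with maximal ideal [I] this is the depth of the ring. *)
Definition depth (A : comPzRingType) (I : set A) : \bar int :=
  nat_esup [set n | exists s : seq A,
    [/\ size s = n, (forall x, x \in s -> I x) & regular_sequence s]].

Section Localization.
Variables (R : comPzRingType) (p : prime_ideal R).

Definition lfrac := {u : R * R | `[< ~ p u.2 >]}.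

Definition lnum (x : lfrac) : R := (val x).1.
Definition lden (x : lfrac) : R := (val x).2.

Lemma ldenP (x : lfrac) : ~ p (lden x).
Proof. by case: x => u pu; apply: asboolW pu. Qed.

Definition LFrac (a s : R) (ps : ~ p s) : lfrac :=
  exist (fun u : R * R => `[< ~ p u.2 >]) (a, s) (asboolT ps).

Lemma prime_outM s t : ~ p s -> ~ p t -> ~ p (s * t).
Proof. by move=> ps pt /prime_mul[]. Qed.

Definition lfrac_eqv (x y : lfrac) : bool :=
  `[< exists2 t, ~ p t & t * (lnum x * lden y) = t * (lnum y * lden x) >].

Lemma lfrac_eqv_refl : reflexive lfrac_eqv.
Proof. by move=> x; apply/asboolP; exists 1 => //; apply: prime_proper. Qed.

Lemma lfrac_eqv_sym : symmetric lfrac_eqv.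
Proof. by move=> x y; apply/asboolP/asboolP => -[t pt e]; exists t. Qed.

Lemma lfrac_eqv_trans : transitive lfrac_eqv.
Proof.
move=> y x z /asboolP[t pt e] /asboolP[u pu f]; apply/asboolP.
exists (t * u * lden y).
  exact: prime_outM (prime_outM pt pu) (@ldenP y).
transitivity ((t * (lnum x * lden y)) * (u * lden z)); first by ring.
rewrite e; transitivity ((u * (lnum y * lden z)) * (t * lden x)); first by ring.
by rewrite f; ring.
Qed.

Canonical lfrac_equiv :=
  EquivRel lfrac_eqv lfrac_eqv_refl lfrac_eqv_sym lfrac_eqv_trans.

Definition localization := {eq_quot lfrac_eqv}.

HB.instance Definition _ : EqQuotient _ lfrac_eqv localization :=
  EqQuotient.on localization.
HB.instance Definition _ := Choice.on localization.

Definition frac (a s : R) (ps : ~ p s) : localization :=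
  \pi_localization (LFrac a ps).

Lemma frac_eq a s (ps : ~ p s) b t (pt : ~ p t) :
  frac a ps = frac b pt <-> exists2 u, ~ p u & u * (a * t) = u * (b * s).
Proof.
split=> [/eqmodP/asboolP //|h]; apply/eqmodP.
by apply/asboolP.
Qed.

Lemma fracW (P : localization -> Prop) :
  (forall a s (ps : ~ p s), P (frac a ps)) -> forall x, P x.
Proof.
move=> h; elim/quotW => -[[a s] ps].
have -> : exist _ (a, s) ps = LFrac a (asboolW ps) by apply: val_inj.
exact: h.
Qed.

Let repr_frac a s (ps : ~ p s) : exists2 u, ~ p u &
  u * (lnum (repr (frac a ps)) * s) = u * (a * lden (repr (frac a ps))).
Proof.
have : \pi_localization (repr (frac a ps)) = \pi_localization (LFrac a ps).
  by rewrite reprK.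
by move=> /eqmodP/asboolP.
Qed.

Let loc0 : localization := frac 0 (@prime_proper R p).
Let loc1 : localization := frac 1 (@prime_proper R p).
Let loc_opp (x : localization) : localization :=
  frac (- lnum (repr x)) (@ldenP (repr x)).
Let loc_add (x y : localization) : localization :=
  frac (lnum (repr x) * lden (repr y) + lnum (repr y) * lden (repr x))
       (prime_outM (@ldenP (repr x)) (@ldenP (repr y))).
Let loc_mul (x y : localization) : localization :=
  frac (lnum (repr x) * lnum (repr y))
       (prime_outM (@ldenP (repr x)) (@ldenP (repr y))).

Let loc_oppE a s (ps : ~ p s) : loc_opp (frac a ps) = frac (- a) ps.
Proof.
have [u pu e] := repr_frac a ps; apply/frac_eq; exists u => //.
by rewrite mulNr mulrN e; ring.
Qed.

Let loc_addE a s (ps : ~ p s) b t (pt : ~ p t) :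
  loc_add (frac a ps) (frac b pt) = frac (a * t + b * s) (prime_outM ps pt).
Proof.
have [u pu e] := repr_frac a ps; have [v pv f] := repr_frac b pt.
apply/frac_eq; exists (u * v); first exact: prime_outM.
set x := repr (frac a ps) in e *; set y := repr (frac b pt) in f *.
transitivity ((u * (lnum x * s)) * (v * lden y * t) +
              (v * (lnum y * t)) * (u * lden x * s)); first by ring.
by rewrite e f; ring.
Qed.

Let loc_mulE a s (ps : ~ p s) b t (pt : ~ p t) :
  loc_mul (frac a ps) (frac b pt) = frac (a * b) (prime_outM ps pt).
Proof.
have [u pu e] := repr_frac a ps; have [v pv f] := repr_frac b pt.
apply/frac_eq; exists (u * v); first exact: prime_outM.
set x := repr (frac a ps) in e *; set y := repr (frac b pt) in f *.
transitivity ((u * (lnum x * s)) * (v * (lnum y * t))); first by ring.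
by rewrite e f; ring.
Qed.

Let frac_eq1 a s (ps : ~ p s) b t (pt : ~ p t) :
  a * t = b * s -> frac a ps = frac b pt.
Proof.
by move=> e; apply/frac_eq; exists 1; [exact: prime_proper|rewrite e].
Qed.

Let loc_addA : associative loc_add.
Proof.
elim/fracW=> a s ps; elim/fracW=> b t pt; elim/fracW=> c u pu.
by rewrite !loc_addE; apply: frac_eq1; ring.
Qed.

Let loc_addC : commutative loc_add.
Proof.
elim/fracW=> a s ps; elim/fracW=> b t pt.
by rewrite !loc_addE; apply: frac_eq1; ring.
Qed.

Let loc_add0 : left_id loc0 loc_add.
Proof. by elim/fracW=> a s ps; rewrite loc_addE; apply: frac_eq1; ring. Qed.

Let loc_addN : left_inverse loc0 loc_opp loc_add.
Proof.
by elim/fracW=> a s ps; rewrite loc_oppE loc_addE; apply: frac_eq1; ring.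
Qed.

HB.instance Definition _ :=
  GRing.isZmodule.Build localization loc_addA loc_addC loc_add0 loc_addN.

Let loc_mulA : associative loc_mul.
Proof.
elim/fracW=> a s ps; elim/fracW=> b t pt; elim/fracW=> c u pu.
by rewrite !loc_mulE; apply: frac_eq1; ring.
Qed.

Let loc_mulC : commutative loc_mul.
Proof.
elim/fracW=> a s ps; elim/fracW=> b t pt.
by rewrite !loc_mulE; apply: frac_eq1; ring.
Qed.

Let loc_mul1 : left_id loc1 loc_mul.
Proof. by elim/fracW=> a s ps; rewrite loc_mulE; apply: frac_eq1; ring. Qed.

Let loc_mulDl : left_distributive loc_mul loc_add.
Proof.
elim/fracW=> a s ps; elim/fracW=> b t pt; elim/fracW=> c u pu.
rewrite (loc_addE _ ps _ pt) (loc_mulE _ ps _ pu) (loc_mulE _ pt _ pu) loc_mulE loc_addE.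
by apply: frac_eq1; ring.
Qed.

Let loc_1neq0 : loc1 != loc0.
Proof.
apply/eqP => /frac_eq[u pu]; rewrite !mulr1 mulr0 => u0.
by apply: pu; rewrite u0; case: (prime_is_ideal p).
Qed.

HB.instance Definition _ := GRing.Zmodule_isComNzRing.Build localization
  loc_mulA loc_mulC loc_mul1 loc_mulDl loc_1neq0.

Lemma fracD a s (ps : ~ p s) b t (pt : ~ p t) :
  frac a ps + frac b pt = frac (a * t + b * s) (prime_outM ps pt).
Proof. exact: loc_addE. Qed.

Lemma fracN a s (ps : ~ p s) : - frac a ps = frac (- a) ps.
Proof. exact: loc_oppE. Qed.

Lemma fracM a s (ps : ~ p s) b t (pt : ~ p t) :
  frac a ps * frac b pt = frac (a * b) (prime_outM ps pt).
Proof. exact: loc_mulE. Qed.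

Lemma frac0 : frac 0 (@prime_proper R p) = 0. Proof. by []. Qed.

Lemma frac1 : frac 1 (@prime_proper R p) = 1. Proof. by []. Qed.

Definition loc_max_ideal : set localization :=
  [set x | exists a s (ps : ~ p s), p a /\ x = frac a ps].

End Localization.

Definition serre_S2 (R : comPzRingType) : Prop :=
  forall p : prime_ideal R,
    (Order.min 2%:E (height p) <= depth (@loc_max_ideal R p))%E.

(** An integral domain as an [idomainType], so that its field of fractions is
    the one of the library; the units and inverses are chosen classically. *)
Definition domain_of (A : comNzRingType) of GRing.integral_domain_axiom A :
  Type := A.

Section DomainOf.
Variables (A : comNzRingType) (domA : GRing.integral_domain_axiom A).
Local Notation D := (domain_of domA).

HB.instance Definition _ := GRing.ComNzRing.copy D A.

Let unit_pred : pred D := fun x => `[< exists y : D, y * x = 1 >].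
Let inverse (x : D) : D :=
  if unit_pred x then xget x [set y : D | y * x = 1] else x.

Let inverse_mul : {in unit_pred, left_inverse 1 inverse *%R}.
Proof.
move=> x; rewrite /in_mem /= /inverse => ux; rewrite ux.
move/asboolP: ux => [y yx].
by case: xgetP => [z _ //|/(_ y)]; case.
Qed.

Let unit_intro (x y : D) : y * x = 1 -> unit_pred x.
Proof. by move=> yx; apply/asboolP; exists y. Qed.

Let inverse_out : {in [predC unit_pred], inverse =1 id}.
Proof. by move=> x; rewrite /in_mem /= /inverse => /negPf ->. Qed.

HB.instance Definition _ := GRing.ComNzRing_hasMulInverse.Build D
  inverse_mul unit_intro inverse_out.

HB.instance Definition _ := GRing.ComUnitRing_isIntegral.Build D domA.

End DomainOf.

Definition integrally_closed_domain (A : comNzRingType) : Prop :=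
  exists domA : GRing.integral_domain_axiom A,
    let D : idomainType := domain_of domA in
    forall x : {fraction D},
      integralOver (@tofrac D) x -> exists a : D, x = tofrac a.

Definition normal_ring (R : comPzRingType) : Prop :=
  forall p : prime_ideal R, integrally_closed_domain (localization p).

Definition finitely_generated (A : comPzRingType) (M : lmodType A) : Prop :=
  exists (n : nat) (v : 'I_n -> M),
    forall x : M, exists c : 'I_n -> A, x = \sum_i c i *: v i.

Definition projective (A : comPzRingType) (P : lmodType A) : Prop :=
  forall (X Y : lmodType A) (g : {linear X -> Y}) (f : {linear P -> Y}),
    (forall y, exists x, g x = y) ->
    exists h : {linear P -> X}, forall u, g (h u) = f u.

Record projective_resolution (A : comPzRingType) (M : lmodType A) :=
  ProjectiveResolution {
    res_term :> nat -> lmodType A;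
    res_diff : forall n, {linear res_term n.+1 -> res_term n};
    res_aug : {linear res_term 0%N -> M};
    res_projective : forall n, projective (res_term n);
    res_aug_surj : forall x : M, exists y, res_aug y = x;
    res_exact0 : forall x, res_aug x = 0 <-> exists y, res_diff 0 y = x;
    res_exactS : forall n x,
      res_diff n x = 0 <-> exists y, res_diff n.+1 y = x
  }.

Definition is_coboundary (A : comPzRingType) (M : lmodType A)
    (P : projective_resolution M) (N : lmodType A) (i : nat) :
    (P i -> N) -> Prop :=
  match i return (P i -> N) -> Prop with
  | 0%N => fun f => forall x, f x = 0
  | j.+1 => fun f =>
      exists g : {linear P j -> N}, forall x, f x = g (res_diff P j x)
  end.

Section Ext.
Variables (A : comPzRingType) (M : lmodType A) (P : projective_resolution M).
Variables (N : lmodType A) (i : nat).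

Definition ext_cocycle : {pred P i -> N} :=
  fun f => `[< linear f /\ forall x, f (res_diff P i x) = 0 >].

Lemma is_coboundary0 : is_coboundary (0 : P i -> N).
Proof. by case: i => [|j] //=; exists \0. Qed.

Lemma is_coboundaryB (f g : P i -> N) :
  is_coboundary f -> is_coboundary g -> is_coboundary (f - g).
Proof.
case: i f g => [|j] f g /=.
  by move=> f0 g0 x; rewrite !fctE f0 g0 subr0.
by move=> [u fu] [v gv]; exists (u \- v) => x; rewrite !fctE fu gv.
Qed.

Lemma ext_cocycle_closed : zmod_closed ext_cocycle.
Proof.
split=> [|f g /asboolP[lf zf] /asboolP[lg zg]]; apply/asboolP; split.
- by move=> a x y; rewrite scaler0 addr0.
- by [].
- move=> a x y; by rewrite !fctE lf lg scalerBr opprD addrACA.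
- by move=> x; rewrite !fctE zf zg subr0.
Qed.
HB.instance Definition _ :=
  GRing.isZmodClosed.Build (P i -> N) ext_cocycle ext_cocycle_closed.

Record cocycle := Cocycle {
  cocycle_fun :> P i -> N;
  cocycleP : cocycle_fun \in ext_cocycle
}.
HB.instance Definition _ := [isSub for cocycle_fun].
HB.instance Definition _ := [Choice of cocycle by <:].
HB.instance Definition _ := [SubChoice_isSubZmodule of cocycle by <:].

Definition ext_coboundary : {pred cocycle} :=
  fun f => `[< is_coboundary f >].

Lemma ext_coboundary_closed : zmod_closed ext_coboundary.
Proof.
split=> [|f g /asboolP cf /asboolP cg]; apply/asboolP.
  exact: is_coboundary0.
exact: is_coboundaryB.
Qed.
HB.instance Definition _ :=
  GRing.isZmodClosed.Build cocycle ext_coboundary ext_coboundary_closed.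

Definition Ext : zmodType := Quotient.quot ext_coboundary.

Lemma Ext_trivialP :
  (forall x : Ext, x = 0) <->
  (forall f : {linear P i -> N},
     (forall x, f (res_diff P i x) = 0) -> is_coboundary f).
Proof.
split=> [E0 f zf|h].
  have cf : (f : P i -> N) \in ext_cocycle.
    by apply/asboolP; split=> // a x y; rewrite linearP.
  have /eqP := E0 (\pi_(Quotient.quot ext_coboundary) (Cocycle cf)); rewrite -(@pi_zeror _ _ _ _ _ (Quotient.quot ext_coboundary)).
  by rewrite -Quotient.idealrBE subr0 => /asboolP.
elim/quotW => f; apply/eqP; rewrite -(@pi_zeror _ _ _ _ _ (Quotient.quot ext_coboundary)).
rewrite -Quotient.idealrBE subr0; apply/asboolP.
have /asboolP[lf zf] := cocycleP f.
pose mf := GRing.isLinear.Build _ _ _ _ (f : P i -> N) lf.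
pose F : {linear P i -> N} := HB.pack (f : P i -> N) mf.
exact: (h F).
Qed.

End Ext.

(** By the comparison theorem the vanishing does not depend on the chosen
    projective resolution. *)
Definition Ext_eq0 (A : comPzRingType) (i : nat) (M N : lmodType A) : Prop :=
  forall (P : projective_resolution M) (x : Ext P N i), x = 0.

Definition Auslander_Reiten (A : comPzRingType) : Prop :=
  forall M : lmodType A, finitely_generated M ->
    (forall i, (0 < i)%N -> Ext_eq0 i M (M * A^o)%type) ->
    projective M.

(* Main.v *)
Require Import Defs.
From HB Require Import structures.
From mathcomp Require Import all_boot all_order fingroup perm all_algebra.
From mathcomp Require Import all_classical constructive_ereal.
From mathcomp Require Import ring.
Import Defs.

Set Implicit Arguments.
Unset Strict Implicit.
Unset Printing Implicit Defensive.

Import Order.TTheory GRing.Theory Num.Theory.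
Local Open Scope classical_set_scope.
Local Open Scope ring_scope.

(** A finitely generated [M] with [Ext^i(M, M + R) = 0] for [i > 0] is replaced
    by a free resolution by matrices. Let [J] be the ideal of those [y] for which
    [y : M -> M] factors through a free module; [M] is projective iff [J = R], and
    [J] does not change when [M] is replaced by a syzygy. If [J] is proper, then
    all primes containing [J] have depth at least 2 (this is where (S2) and the
    hypothesis in height at most 1, or normality, enter), so [J] has grade at
    least 2. Choose a maximal regular sequence [x] in [J], and [s] such that
    [p = (x : s)] is a prime containing [J]; replace [M] by a high syzygy
    [M <= F] with [F/M] not free at [p]. Then there are [m] in [M], lying in [p F],
    and [phi : M -> R/p] with [phi m <> 0]. Here [s m] lies in [x M], and
    [s phi : M -> R/x] lifts to [psi : M -> R], so the endomorphism
    [psi (_) m] has its image in [x M]. As the [Ext^i(M, M)] vanish, it lies in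
    [x End(M)]. Since [J] has grade at least 2, the evaluation
    [M^* (x) M -> R] extends to an [R]-linear trace [End(M) -> R]. Hence
    [psi m = tr (psi (_) m)] lies in [(x)], whereas modulo [x] it is [s phi m], which
    is nonzero because [phi m] is not in [p]. *)

(** * Ideals of a noetherian ring *)

Section Noetherian.
Variable R : comPzRingType.
Implicit Types (I J K : set R) (x y z : R).

Lemma ideal_sum I n (f : 'I_n -> R) :
  is_ideal I -> (forall i, I (f i)) -> I (\sum_i f i).
Proof. by case=> I0 ID _ If; elim/big_ind: _. Qed.

Lemma idealB I x y : is_ideal I -> I x -> I y -> I (x - y).
Proof. by case=> _ ID IM Ix Iy; apply: ID => //; rewrite -mulN1r; apply: IM. Qed.

Lemma ideal_is0 : is_ideal [set 0 : R].
Proof.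
split=> //= [x y -> ->|a x ->]; first by rewrite addr0.
by rewrite mulr0.
Qed.

Lemma ideal_principal x : is_ideal [set y | exists a, y = a * x].
Proof.
split=> [|y z [a ->] [b ->]|a y [b ->]]; first by exists 0; rewrite mul0r.
  by exists (a + b); rewrite mulrDl.
by exists (a * b); rewrite mulrA.
Qed.

Lemma ideal_add_principal I a :
  is_ideal I -> is_ideal [set x | exists r, I (x - r * a)].
Proof.
case=> I0 ID IM; split=> [|x y [r Ir] [s Is]|b x [r Ir]].
- by exists 0; rewrite mul0r subr0.
- by exists (r + s); rewrite mulrDl opprD addrACA; apply: ID.
- by exists (b * r); rewrite -mulrA -mulrBr; apply: IM.
Qed.

Lemma span_ideal_mem (s : seq R) x : x \in s -> span_ideal s x.
Proof.
move=> xs; have lt := xs; rewrite -index_mem in lt.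
exists (fun i => (i == Ordinal lt)%:R); rewrite (bigD1 (Ordinal lt)) //= eqxx.
by rewrite mul1r nth_index // big1 ?addr0 // => i /negPf ->; rewrite mul0r.
Qed.

Lemma span_ideal_sub I (s : seq R) :
  is_ideal I -> (forall x, x \in s -> I x) -> span_ideal s `<=` I.
Proof.
move=> Ii Is _ [c ->]; apply: ideal_sum => // i.
by case: Ii => _ _; apply; apply/Is/mem_nth.
Qed.

Hypothesis noethR : noetherian R.

(** Without a maximal member, choice yields a strictly increasing chain of ideals; its union is
    finitely generated, so the chain stops growing once all generators have appeared. *)
Lemma noetherian_maximal (F : set (set R)) : (forall I, F I -> is_ideal I) ->
  F !=set0 -> exists2 I, F I & forall I', F I' -> I `<=` I' -> I' `<=` I.
Proof.
move=> Fi [I0 FI0]; apply: contrapT => nomax.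
have next (I : {I | F I}) : exists I' : {I | F I}, sval I `<` sval I'.
  apply: contrapT => no; apply: nomax; exists (sval I); first exact: svalP.
  move=> I' FI' II'; apply: contrapT => nI; apply: no.
  by exists (exist _ I' FI'); split.
have [g gP] := choice next.
pose c n := sval (iter n g (exist _ I0 FI0)).
have cI n : is_ideal (c n) by apply/Fi/svalP.
have cS n : c n `<=` c n.+1 by have /properW := gP (iter n g (exist _ I0 FI0)).
have cM : {homo c : m n / (m <= n)%N >-> m `<=` n}.
  by apply: homo_leq cS => [A|B A C]; [exact: subset_refl|exact: subset_trans].
have UI : is_ideal (\bigcup_n c n).
  split=> [|x y [m _ cx] [n _ cy]|a x [n _ cx]].
  - by exists 0%N => //; case: (cI 0%N).
  - exists (maxn m n) => //; have [_ cD _] := cI (maxn m n); apply: cD.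
      exact: (cM _ _ (leq_maxl m n)).
    exact: (cM _ _ (leq_maxr m n)).
  - by exists n => //; case: (cI n) => _ _; apply.
have [s Us] := noethR UI.
have [N sN] : exists N, forall x, x \in s -> c N x.
  have : forall x, x \in s -> (\bigcup_n c n) x.
    by move=> x xs; rewrite Us; apply: span_ideal_mem.
  elim: s {Us} => [|a s IH] sU; first by exists 0%N.
  have [|N sN] := IH; first by move=> x xs; apply: sU; rewrite inE xs orbT.
  have [|m _ cm] := sU a; first by rewrite inE eqxx.
  exists (maxn m N) => x; rewrite inE => /orP[/eqP ->|/sN].
    exact: (cM _ _ (leq_maxl m N)).
  exact: (cM _ _ (leq_maxr m N)).
have [_] : c N `<` c N.+1 by exact: gP.
apply=> x cx; apply: (span_ideal_sub (cI N) sN).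
by rewrite -Us; exists N.+1.
Qed.

(** The incremental form of prime avoidance: [y] is corrected by an element of
    [J] lying in all previous associated primes but not in the next one. *)
Lemma nonzerodivisor_or_prime_annihilator I J : is_ideal I -> ~ I 1 ->
    is_ideal J ->
  (exists2 y, J y & forall x, I (y * x) -> I x) \/
  exists (p : prime_ideal R) s, [/\ ~ I s, J `<=` prime_set p
    & prime_set p = [set r | I (r * s)]].
Proof.
move=> Ii I1 Ji.
pose colon (K : set R) : set R := [set r | forall k, K k -> I (r * k)].
have [I0 ID IM] := Ii.
have colonI K : is_ideal (colon K).
  split=> [k _|x y cx cy k Kk|a x cx k Kk]; first by rewrite mul0r.
    by rewrite mulrDl; apply: ID; [exact: cx|exact: cy].
  by rewrite -mulrA; apply/IM/cx.
pose ann a : set R := [set r | I (r * a)].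
have annI a : is_ideal (ann a).
  split=> [|x y|b x]; rewrite /ann /= ?mul0r ?mulrDl -?mulrA //.
    exact: ID.
  exact: IM.
(* The [ann a] with [maxann a] are maximal among the annihilators of nonzero classes of R/I, which
   makes them prime. *)
pose maxann a := ~ I a /\ forall b, ~ I b -> ann a `<=` ann b ->
  ann b `<=` ann a.
have annP a : maxann a -> forall x y, ann a (x * y) -> ann a x \/ ann a y.
  move=> [aI amax] x y axy; have [Iy|nIy] := pselect (I (y * a)); first by right.
  left; apply: (amax (y * a)) => // [r ar|]; last by rewrite /ann /= mulrA.
  by rewrite /ann /= mulrCA; apply: IM.
have maxannE a : ~ I a -> exists2 b, maxann b & ann a `<=` ann b.
  move=> aI.
  pose F K := exists b, [/\ K = ann b, ~ I b & ann a `<=` ann b].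
  have [|| K [b [-> bI ab]] bmax] := noetherian_maximal (F := F).
  - by move=> _ [b [-> _ _]].
  - by exists (ann a), a; split.
  exists b => //; split=> // c cI bc; apply: bmax => //.
  by exists c; split=> //; apply: subset_trans bc.
have [[a [aI am] Ja]|noJ] := pselect (exists2 a, maxann a & J `<=` ann a).
  right; have a1 : ~ ann a 1 by rewrite /ann /= mul1r.
  by exists (PrimeIdeal (annI a) a1 (annP a (conj aI am))), a.
left.
(* [inv K y] asks [y] in J to avoid every maximal annihilator containing (I : K). Enlarging K
   shrinks (I : K), so a largest K admitting such a [y] is taken. At K = I the condition is vacuous,
   since 1 lies in (I : I). *)
pose inv K y := J y /\ forall a, maxann a -> colon K `<=` ann a -> ~ ann a y.
pose F K := [/\ is_ideal K, I `<=` K & exists y, inv K y].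
have [|| K [Ki IK [y [Jy yP]]] Kmax] := noetherian_maximal (F := F).
- by move=> ? [].
- exists I; split=> //; exists 0; split; first by case: Ji.
  move=> a [aI _] Ia; have /Ia : colon I 1 by move=> k; rewrite mul1r.
  by rewrite /ann /= mul1r.
exists y => // x Iyx; apply: contrapT => nIx.
have [a ma xa] := maxannE _ nIx.
have ya : ann a y by apply: xa.
have /existsNP[z1 /not_implyP[Jz1 az1]] : ~ (J `<=` ann a).
  by move=> Ja; apply: noJ; exists a.
have /existsNP[z2 /not_implyP[Kz2 az2]] : ~ (colon K `<=` ann a).
  by move=> Ka; apply: (yP a).
(* [z] lies in J and in (I : K) but not in [ann a], so that [y + z] serves for K + (a). Maximality
   then puts [a] in K, against the choice of [z2]. *)
pose z := z1 * z2.
have az : ~ ann a z by move=> /(annP _ ma)[].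
have Jz : J z by case: Ji => _ _ JM; rewrite /z mulrC; apply: JM.
have Kz : colon K z by move=> k Kk; rewrite /z -mulrA; apply/IM/Kz2.
pose K' := [set x | exists r, K (x - r * a)].
have KK' : K `<=` K' by move=> k Kk; exists 0; rewrite mul0r subr0.
have FK' : F K'.
  split; [exact: ideal_add_principal|exact: subset_trans KK'|].
  exists (y + z); split; first by case: Ji => _ JD _; apply: JD.
  move=> b mb K'b byz.
  have [Kb|] := pselect (colon K `<=` ann b).
    apply: (yP b mb Kb); rewrite -[y](addrK z).
    exact: idealB (annI b) byz (Kb _ Kz).
  move=> /existsNP[w /not_implyP[Kw bw]].
  (* The element [w] multiplies [ann a] into (I : K + (a)), hence into the prime [ann b], which
     misses [w]. By maximality the two annihilators coincide. *)
  have ab : ann a `<=` ann b.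
    move=> r ar; have /K'b/(annP _ mb)[//|//] : colon K' (r * w).
    move=> k [t Kk]; rewrite -(subrK (t * a) k) mulrDr; apply: ID.
      by rewrite -mulrA; apply/IM/Kw.
    have -> : r * w * (t * a) = (w * t) * (r * a) by ring.
    exact: IM.
  apply: az; rewrite -[z](addKr y) addrC.
  apply: (idealB (annI a)) => //.
  by case: ma => _ /(_ b) ; case: mb => bI _ /(_ bI ab); apply.
have Ka : K a.
  apply: (Kmax K') => //; exists 1; rewrite mul1r subrr; by case: Ki.
by apply: az2; apply: Kz2.
Qed.
End Noetherian.

(** * Complexes modulo a regular sequence *)

Section Comb.
Variable R : comPzRingType.

Definition is_submod (V : lmodType R) (S : set V) : Prop :=
  S 0 /\ forall a u v, S u -> S v -> S (a *: u + v).

Lemma submodD (V : lmodType R) (S : set V) u v :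
  is_submod S -> S u -> S v -> S (u + v).
Proof. by move=> [_ SP] Su Sv; rewrite -[u]scale1r; apply: SP. Qed.

Lemma submodZ (V : lmodType R) (S : set V) a u : is_submod S -> S u -> S (a *: u).
Proof. by move=> [S0 SP] Su; rewrite -[_ *: _]addr0; apply: SP. Qed.

Lemma submodB (V : lmodType R) (S : set V) u v :
  is_submod S -> S u -> S v -> S (u - v).
Proof.
by move=> SS Su Sv; apply: submodD => //; rewrite -scaleN1r; apply: submodZ.
Qed.

Lemma submodT (V : lmodType R) : is_submod [set: V].
Proof. by []. Qed.

(** [comb S xs] is the submodule [(xs) S]. Sequences are listed backwards: in
    [x :: xs] the element [x] comes after those of [xs]. *)
Fixpoint comb (V : lmodType R) (S : set V) (xs : seq R) : set V :=
  if xs is x :: xs' then [set v | exists2 w, S w & comb S xs' (v - x *: w)]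
  else [set 0].

(** Weak regularity: each [x] is a nonzerodivisor on S/(xs')S, and (xs) S may be all of S. *)
Fixpoint regular_on (V : lmodType R) (S : set V) (xs : seq R) : Prop :=
  if xs is x :: xs' then
    regular_on S xs' /\ forall v, S v -> comb S xs' (x *: v) -> comb S xs' v
  else True.

Lemma comb_submod (V : lmodType R) (S : set V) xs :
  is_submod S -> is_submod (comb S xs).
Proof.
move=> SS; elim: xs => [|x xs IH] /=.
  by split=> //= a u v -> ->; rewrite scaler0 addr0.
split=> [|a u v [w Sw uw] [w' Sw' vw']].
  by exists 0; [case: SS|rewrite scaler0 subr0; case: IH].
exists (a *: w + w'); first by case: SS => _; apply.
rewrite scalerDr scalerA mulrC -scalerA opprD addrACA -scalerBr.
by case: IH => _; apply.
Qed.

Lemma comb_behead (V : lmodType R) (S : set V) x xs :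
  is_submod S -> comb S xs `<=` comb S (x :: xs).
Proof.
by move=> [S0 _] v cv; exists 0 => //; rewrite scaler0 subr0.
Qed.

Lemma comb_linear (U V : lmodType R) (f : U -> V) (S : set U) (S' : set V) xs :
  linear f -> (forall u, S u -> S' (f u)) ->
  forall u, comb S xs u -> comb S' xs (f u).
Proof.
move=> lf SS'; have fP a u v : f (u - a *: v) = f u - a *: f v.
  by rewrite -!scaleNr addrC lf addrC.
elim: xs => [u -> /=|x xs IH u [w Sw /IH]]; last first.
  by rewrite fP => ?; exists (f w); first exact: SS'.
by have := fP 1 0 0; rewrite !scale1r !subrr => ->.
Qed.

Lemma comb_subset (V : lmodType R) (S S' : set V) xs :
  S `<=` S' -> comb S xs `<=` comb S' xs.
Proof. by move=> SS' v; apply: (comb_linear (f := idfun)). Qed.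

Lemma comb_ideal xs : is_ideal (comb [set: R^o] xs : set R).
Proof.
have [c0 cP] := comb_submod xs (submodT R^o).
split=> // [x y|a x] cx; first exact: submodD (comb_submod xs (submodT R^o)) cx.
exact: submodZ (comb_submod xs (submodT R^o)) cx.
Qed.

Lemma comb_mem x xs : comb [set: R^o] (x :: xs) x.
Proof.
exists 1 => //=; rewrite [x *: _]mulr1 subrr.
by have [] := comb_submod xs (submodT R^o).
Qed.

Lemma comb_sub_ideal (J : set R) xs :
  is_ideal J -> (forall x, x \in xs -> J x) -> comb [set: R^o] xs `<=` J.
Proof.
move=> Ji; elim: xs => [_ v ->|x xs IH xJ v [w _ /IH vw]]; first by case: Ji.
rewrite -(subrK (x *: w) v); case: (Ji) => _ JD JM; apply: JD.
  by apply: vw => y yxs; apply: xJ; rewrite inE yxs orbT.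
by rewrite [x *: _]mulrC; apply/JM/xJ; rewrite inE eqxx.
Qed.

Lemma comb_mx m n xs (A : 'M[R]_(m, n)) :
  comb [set: 'M[R]_(m, n)] xs A <-> forall i j, comb [set: R^o] xs (A i j).
Proof.
split=> [cA i j|].
  by apply: (comb_linear (f := fun B : 'M_(m, n) => B i j : R^o)) cA => // a B C;
     rewrite !mxE.
elim: xs A => [A A0|x xs IH A Ax] /=; first by apply/matrixP=> i j; rewrite mxE A0.
have /choice[W WP] (ij : 'I_m * 'I_n) :
    exists w : R^o, comb [set: R^o] xs ((A ij.1 ij.2 : R^o) - x *: w).
  by have [w _ cw] := Ax ij.1 ij.2; exists w.
exists (\matrix_(i, j) W (i, j)) => //; apply: IH => i j; rewrite !mxE.
exact: (WP (i, j)).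
Qed.

Lemma regular_on_mx m n xs :
  regular_on [set: R^o] xs -> regular_on [set: 'M[R]_(m, n)] xs.
Proof.
elim: xs => //= x xs IH [/IH rxs xP]; split=> // A _ /comb_mx xA.
by apply/comb_mx => i j; apply: xP => //; have := xA i j; rewrite mxE.
Qed.

Section Cochain.
Variables (V : nat -> lmodType R) (S : forall k, set (V k)).
Variable d : forall k, V k -> V k.+1.
Hypothesis S_submod : forall k, is_submod (@S k).
Hypothesis d_linear : forall k, linear (@d k).
Hypothesis dS : forall k u, S u -> S (@d k u).
Hypothesis dd : forall k u, d (@d k u) = 0.
Variable k0 : nat.
Hypothesis d_exact : forall k v, (k0 <= k)%N -> @S k.+1 v -> d v = 0 ->
  exists2 u, @S k u & v = d u.

Let dP k a u v : @d k (u - a *: v) = d u - a *: d v.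
Proof. by rewrite -!scaleNr addrC d_linear addrC. Qed.

(** Applying [d] to w = x q modulo (xs) gives x d q = 0 modulo (xs), and regularity cancels [x]. *)
Lemma cochain_regular k x xs q w :
  regular_on (@S k.+1) (x :: xs) -> @S k q ->
  d (w : V k) = 0 -> comb (@S k) xs (w - x *: q) -> comb (@S k.+1) xs (d q).
Proof.
move=> [_ reg] Sq dw0 cw; apply: reg; first exact: dS.
have := comb_linear (d_linear (k := k)) (@dS k) cw.
rewrite dP dw0 sub0r -scaleN1r => /(submodZ (-1) (comb_submod xs (S_submod _))).
by rewrite scalerA mulrNN mul1r scale1r.
Qed.

(** Exactness above [k0] survives modulo a regular sequence. If d v = x q modulo (xs), then q is a
    cocycle modulo (xs), so q = d q' there by induction one degree up, and v - x q' is a cocycle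
    modulo (xs). *)
Lemma cochain_lift xs : (forall k, (k0 < k)%N -> regular_on (@S k) xs) ->
  forall k v, (k0 <= k)%N -> @S k.+1 v -> comb (@S k.+2) xs (d v) ->
  exists2 u, @S k u & comb (@S k.+1) xs (v - d u).
Proof.
elim: xs => [|x xs IH] reg k v k0k Sv.
  move=> dv; have [u Su ->] := d_exact k0k Sv dv.
  by exists u => //=; rewrite subrr.
have regxs j : (k0 < j)%N -> regular_on (@S j) xs by move=> /reg[].
move=> [q Sq dvq].
have [|q' Sq' qq'] := IH regxs k.+1 q (leqW k0k) Sq.
  by apply: cochain_regular (reg _ _) Sq (dd v) dvq; rewrite ltnS !leqW.
have Sv' : S (v - x *: q') by apply: submodB => //; apply: submodZ.
have [|u Su vu] := IH regxs k (v - x *: q') k0k Sv'.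
  rewrite dP -[_ - _](subrKA (x *: q)) -scalerBr.
  by apply: submodD dvq _; [|apply: submodZ qq']; apply: comb_submod.
by exists u => //; exists q' => //; rewrite addrAC.
Qed.

(** The same correction in the bottom degree [k0], where cocycles need not be coboundaries: a
    cocycle modulo (xs) lifts to a true cocycle. *)
Lemma cocycle_lift xs : (forall k, (k0 < k)%N -> regular_on (@S k) xs) ->
  forall z : V k0, S z -> comb (@S k0.+1) xs (d z) ->
  exists2 c, S c /\ d c = 0 & comb (@S k0) xs (z - c).
Proof.
elim: xs => [|x xs IH] reg z Sz; first by move=> dz; exists z => //=; rewrite subrr.
have regxs j : (k0 < j)%N -> regular_on (@S j) xs by move=> /reg[].
move=> [q Sq dzq].
have [|q' Sq' qq'] := cochain_lift regxs (leqnn k0) Sq.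
  by apply: cochain_regular (reg _ _) Sq (dd z) dzq; rewrite ltnS leqW.
have Sz' : S (z - x *: q') by apply: submodB => //; apply: submodZ.
have [|c Sc zc] := IH regxs (z - x *: q') Sz'.
  rewrite dP -[_ - _](subrKA (x *: q)) -scalerBr.
  by apply: submodD dzq _; [|apply: submodZ qq']; apply: comb_submod.
by exists c => //; exists q' => //; rewrite addrAC.
Qed.

(** For the module Z of cocycles in degree [k0], (xs) S meets Z in (xs) Z: the coefficient of [x] is
    a cocycle modulo the other elements and can be replaced by a true one. *)
Lemma comb_cocycle xs : (forall k, (k0 < k)%N -> regular_on (@S k) xs) ->
  forall e : V k0, comb (@S k0) xs e -> d e = 0 ->
  comb [set c | @S k0 c /\ d c = 0] xs e.
Proof.
elim: xs => [//|x xs IH] reg e [z Sz ez] de.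
have regxs j : (k0 < j)%N -> regular_on (@S j) xs by move=> /reg[].
have [|c [Sc dc] zc] := cocycle_lift regxs Sz.
  exact: cochain_regular (reg _ (ltnSn k0)) Sz de ez.
exists c; first by [].
apply: IH => //; last by rewrite dP de dc scaler0 subr0.
rewrite -[_ - _](subrKA (x *: z)) -scalerBr.
by apply: submodD ez _; [|apply: submodZ zc]; apply: comb_submod.
Qed.

End Cochain.

(** Here [d] lowers degrees, so each element of [xs] costs one degree; hence [size xs <= k]. For a
    free resolution this is the vanishing of Tor with R/(xs) in degrees above the length of [xs]. *)
Lemma chain_lift (V : nat -> lmodType R) (d : forall k, V k.+1 -> V k) xs :
    (forall k, linear (d k)) -> (forall k u, d k (d k.+1 u) = 0) ->
    (forall k u, d k u = 0 -> exists v, u = d k.+1 v) ->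
    (forall k, regular_on [set: V k] xs) ->
  forall k u, (size xs <= k)%N -> comb [set: V k] xs (d k u) ->
  exists v, comb [set: V k.+1] xs (u - d k.+1 v).
Proof.
move=> ld dd ex; have dP k a u v : d k (u - a *: v) = d k u - a *: d k v.
  by rewrite -!scaleNr addrC ld addrC.
elim: xs => [|x xs IH] reg k u sk.
  by move=> /ex[v ->]; exists v => /=; rewrite subrr.
have regxs j : regular_on [set: V j] xs by case: (reg j).
case: k u sk => // k u sk [q _ uq].
have [||q' qq'] := IH regxs k q; first by [].
  apply: (reg k).2 => //.
  have := comb_linear (ld k) (S' := setT) (fun _ _ => I) uq.
  rewrite dP dd sub0r -scaleN1r => /(submodZ (-1) (comb_submod xs (submodT _))).
  by rewrite scalerA mulrNN mul1r scale1r.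
have [||v uv] := IH regxs k.+1 (u - x *: q'); first exact: ltnW.
  rewrite dP -[_ - _](subrKA (x *: q)) -scalerBr.
  by apply: submodD uq _; [|apply: submodZ qq']; apply: comb_submod.
by exists v, q' => //; rewrite addrAC.
Qed.

End Comb.

(** * Matrices of constant residual rank *)

Section ResidueMatrix.
Variables (R : comPzRingType) (p : prime_ideal R).

Definition in_mx m n (A : 'M[R]_(m, n)) : Prop := forall i j, p (A i j).

Lemma in_mxZ m n c (A : 'M[R]_(m, n)) : in_mx A -> in_mx (c *: A).
Proof.
by move=> pA i j; rewrite mxE; have [_ _] := prime_is_ideal p; apply.
Qed.

(** Gaussian elimination over the residue field at [p]: [c^-1 V] is a
    generalized inverse of [D] there. *)
Lemma residue_pseudo_inverse a b (D : 'M[R]_(a, b)) :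
  exists c V, ~ p c /\ in_mx (c *: D - D *m V *m D).
Proof.
pose bad (D : 'M[R]_(a, b)) := [set i | ~~ `[< forall j, p (D i j) >]]%SET.
have [N] := ubnP #|bad D|; elim: N D => // N IH D; rewrite ltnS => DN.
have [pD|/existsNP[i /existsNP[j pij]]] := pselect (in_mx D).
  exists 1, 0; split; first exact: prime_proper.
  by rewrite mulmx0 mul0mx scale1r subr0.
pose d := D i j; pose e : 'M[R]_(b, a) := delta_mx j i.
(* Elimination with pivot [d]: row [i] of [D1] is zero and rows already in p stay there, so [bad]
   shrinks. *)
pose D1 := d *: D - D *m e *m D.
have D1E k l : D1 k l = d * D k l - D k j * D i l.
  rewrite !mxE (bigD1 i) //= big1 ?addr0 => [|k' /negPf k'i]; last first.
    rewrite !mxE big1 ?mul0r // => l' _; rewrite !mxE k'i andbF mulr0 //.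
  rewrite mxE (bigD1 j) //= big1 ?addr0 => [|k' /negPf k'i]; last first.
    by rewrite !mxE k'i mulr0.
  by rewrite !mxE !eqxx mulr1.
have [p0 pD pM] := prime_is_ideal p.
have lt : (#|bad D1| < N)%N.
  apply: leq_trans DN; apply: proper_card; apply/properP; split.
    apply/fintype.subsetP => k; rewrite !inE; apply: contra => /asboolP pk.
    apply/asboolP => l; rewrite D1E; apply: (idealB (prime_is_ideal p)).
      exact: pM.
    by rewrite mulrC; apply: pM.
  exists i; rewrite inE; first by apply/asboolPn => /(_ j).
  rewrite negbK; apply/asboolP => l.
  by rewrite D1E subrr.
have [c [V [pc cV]]] := IH D1 lt.
exists (c * d), (c *: e + (d%:M - e *m D) *m V *m (d%:M - D *m e)).
split; first exact: prime_outM.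
suff -> : (c * d) *: D - D *m (c *: e + (d%:M - e *m D) *m V *m (d%:M - D *m e)) *m D
    = c *: D1 - D1 *m V *m D1 by [].
have D1l : D1 = D *m (d%:M - e *m D).
  by rewrite mulmxBr mul_mx_scalar mulmxA.
have D1r : D1 = (d%:M - D *m e) *m D by rewrite mulmxBl mul_scalar_mx.
rewrite mulmxDr mulmxDl {2}D1l {2}D1r !mulmxA opprD addrA; congr (_ - _).
by rewrite /D1 scalerBr scalerA -scalemxAr -scalemxAl.
Qed.

Lemma det_residue_scalar n (A : 'M[R]_n) c :
  ~ p c -> in_mx (A - c%:M) -> ~ p (\det A).
Proof.
move=> pc pA; suff h : p (\det A - c ^+ n).
  move=> pdet; have {pdet}h : p (c ^+ n).
    by rewrite -(subKr (\det A) (c ^+ n)); apply: idealB => //; exact: prime_is_ideal.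
  elim: n h {A pA} => [|n IH]; first by rewrite expr0; apply: prime_proper.
  by rewrite exprS => /prime_mul[].
have [p0 pD pM] := prime_is_ideal p.
rewrite /determinant (bigD1 (1%g : {perm 'I_n})) //= odd_perm1 expr0 mul1r addrAC.
apply: (pD); last first.
  elim/big_ind: _ => [||s s1]; [exact: p0|exact: pD|apply: (pM)].
  have [i si] : exists i, s i != i.
    apply/existsP; apply: contraR s1; rewrite negb_exists => /forallP si.
    by apply/eqP/permP => i; rewrite perm1; apply/eqP; have := si i; rewrite negbK.
  rewrite (bigD1 i) //= mulrC; apply: (pM).
  by have := pA i (s i); rewrite !mxE eq_sym (negPf si) mulr0n subr0.
have -> : c ^+ n = \prod_(i < n) c by rewrite prodr_const card_ord.
elim/big_rec2: _ => [|i x y _ pxy]; first by rewrite subrr.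
rewrite perm1; have -> : A i i * y - c * x = A i i * (y - x) + x * (A i i - c) by ring.
apply: (pD); apply: (pM) => //.
by have := pA i i; rewrite !mxE eqxx mulr1n.
Qed.
End ResidueMatrix.

(** Modulo matrices of the form D G D, a polynomial in T acts on D through its constant term. For
    the characteristic polynomial this term is the determinant up to sign, and Cayley-Hamilton makes
    the left side zero. *)
Lemma det_mx_factor_nz (R : comNzRingType) a b (D : 'M[R]_(a, b))
    (T : 'M_a) (Y : 'M_(b, a)) :
  T *m D = D *m Y *m D -> exists W, \det T *: D = D *m W *m D.
Proof.
case: a D T Y => [|a] D T Y TD; first by exists 0; rewrite [LHS]flatmx0 [RHS]flatmx0.
have hP (q : {poly R}) : exists G, horner_mx T q *m D = q`_0 *: D + D *m G *m D.
  elim/poly_ind: q => [|q c [G qG]].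
    by exists 0; rewrite rmorph0 coef0 scale0r mulmx0 !mul0mx addr0.
  exists (((q`_0)%:M + G *m D) *m Y).
  rewrite rmorphD rmorphM /= horner_mx_X horner_mx_C coefD coefMX coefC /= add0r.
  rewrite mulmxDl mul_scalar_mx addrC; congr (_ + _).
  have -> : horner_mx T q * T *m D = horner_mx T q *m (T *m D) by rewrite mulmxA.
  have -> : D *m (((q`_0)%:M + G *m D) *m Y) = (q`_0 *: D + D *m G *m D) *m Y.
    by rewrite mulmxA mulmxDr mul_mx_scalar mulmxA.
  by rewrite TD -qG !mulmxA.
have [G] := hP (char_poly T).
rewrite Cayley_Hamilton mul0mx char_poly_det -scalerA => /esym/eqP.
rewrite addr_eq0 => /eqP h; exists (- ((-1) ^+ a.+1 *: G)).
rewrite mulmxN mulNmx -scalemxAr -scalemxAl -scalerN -h !scalerA.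
by rewrite mulrA -exprMn mulrNN mulr1 expr1n mul1r.
Qed.

Lemma det_mx_factor (R : comPzRingType) a b (D : 'M[R]_(a, b))
    (T : 'M_a) (Y : 'M_(b, a)) : (1 : R) <> 0 ->
  T *m D = D *m Y *m D -> exists W, \det T *: D = D *m W *m D.
Proof.
move=> /eqP n10.
pose R' : comNzRingType :=
  HB.pack (GRing.ComPzRing.sort R) (GRing.PzSemiRing_isNonZero.Build R n10).
exact: (@det_mx_factor_nz R').
Qed.

(** If the complex [C], [D] has no homology over the residue field at [p], then
    the module presented by [D] is free at [p]. *)
Lemma residue_exact_split (R : comPzRingType) (p : prime_ideal R) c a b
    (C : 'M[R]_(c, a)) (D : 'M_(a, b)) : C *m D = 0 ->
    (forall (u : 'rV_a) (z : 'cV_a), in_mx p (u *m D) -> in_mx p (C *m z) ->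
       in_mx p (u *m z)) ->
  exists y W, ~ p y /\ y *: D = D *m W *m D.
Proof.
move=> CD uz.
have [d [V [pd dV]]] := residue_pseudo_inverse p D.
have [e [U [pe eU]]] := residue_pseudo_inverse p C.
(* [X] and [Y] form a contracting homotopy over the residue field: de - T = (d - D V)(e - U C). Rows
   of the first factor are cycles modulo p, columns of the second are cocycles, so by hypothesis the
   product lies in p. *)
pose Y := e *: V; pose X := d *: U - D *m V *m U.
pose T := X *m C + D *m Y.
have pT : in_mx p ((d * e)%:M - T).
  have -> : (d * e)%:M - T = (d%:M - D *m V) *m (e%:M - U *m C).
    rewrite /T /X /Y mulmxBr !mulmxBl !mul_scalar_mx mul_mx_scalar.
    rewrite scale_scalar_mx -scalemxAl -scalemxAr !mulmxA.
    by rewrite opprD addrA addrAC.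
  move=> i j; set A := d%:M - _; set B := e%:M - _.
  have -> : (A *m B) i j = (row i A *m col j B) 0 0.
    by rewrite !mxE; apply: eq_bigr => k _; rewrite !mxE.
  apply: uz.
    by rewrite -row_mul => ? ?; rewrite mxE mulmxBl mul_scalar_mx.
  by rewrite colE mulmxA -colE => ? ?; rewrite mxE mulmxBr mul_mx_scalar mulmxA.
have TD : T *m D = D *m Y *m D by rewrite mulmxDl -mulmxA CD mulmx0 add0r.
have [|W TW] := det_mx_factor _ TD.
  by move=> n; apply: (@prime_proper _ p); rewrite n; case: (prime_is_ideal p).
exists (\det T), W; split=> //; apply: (det_residue_scalar (prime_outM pd pe)).
by have := in_mxZ (-1) pT; rewrite scaleN1r opprB.
Qed.

(** * Modules without self-extensions *)

(** The matrices [D i] act on row vectors and form a free resolution of a module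
    [M]; [rr_ext_ring] and [rr_ext_self] say that [Ext^j(M, R)] and
    [Ext^j(N, N)] vanish for [j > 0] and all syzygies [N] of [M]. *)
Record rigid_resolution (R : comPzRingType) (n : nat -> nat)
    (D : forall i, 'M[R]_(n i.+1, n i)) : Prop := RigidResolution {
  rr_complex : forall i, D i.+1 *m D i = 0;
  rr_exact : forall i (u : 'rV_(n i.+1)),
    u *m D i = 0 -> exists v, u = v *m D i.+1;
  rr_ext_ring : forall i (v : 'cV_(n i.+1)),
    D i.+1 *m v = 0 -> exists w, v = D i *m w;
  rr_ext_self : forall i k (Z : 'M_(n k.+1, n i.+1)), (i < k)%N ->
    D k.+1 *m Z *m D i = 0 -> exists Y, Z *m D i = D k *m Y *m D i
}.

Lemma row_factor (R : pzSemiRingType) m n k (A : 'M[R]_(m, n)) (B : 'M_(k, n)) :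
  (forall j, exists v, row j A = v *m B) -> exists C, A = C *m B.
Proof.
move=> /choice[f fP]; exists (\matrix_j f j); apply/row_matrixP => j.
by rewrite row_mul rowK.
Qed.

Lemma col_factor (R : pzSemiRingType) m n k (A : 'M[R]_(m, n)) (B : 'M_(m, k)) :
  (forall j, exists w, col j A = B *m w) -> exists C, A = B *m C.
Proof.
move=> /choice[f fP]; exists (\matrix_(i, j) f j i 0); apply/matrixP => i j.
have /matrixP/(_ i 0) := fP j; rewrite !mxE => ->.
by apply: eq_bigr => l _; rewrite !mxE.
Qed.

Section RigidResolution.
Variables (R : comPzRingType) (n : nat -> nat).
Variable D : forall i, 'M[R]_(n i.+1, n i).
Hypothesis rrD : rigid_resolution D.

Lemma rr_exact_mx i m (A : 'M_(m, n i.+1)) :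
  A *m D i = 0 -> exists B, A = B *m D i.+1.
Proof.
move=> AD; apply: row_factor => j.
by apply: (rr_exact rrD); rewrite -row_mul AD row0.
Qed.

Lemma rr_ext_ring_mx i m (A : 'M_(n i.+1, m)) :
  D i.+1 *m A = 0 -> exists B, A = D i *m B.
Proof.
move=> DA; apply: col_factor => j.
by apply: (rr_ext_ring rrD); rewrite colE mulmxA DA mul0mx.
Qed.

(** The ideal of the [y] whose action on [M] factors through a free module. *)
Definition splitting : set R := [set y | exists W, y *: D 0 = D 0 *m W *m D 0].

(** Multiplication by [y] is null-homotopic: exactness turns y - D_i W into V D_{i+1}, which gives
    the next degree, and exactness of the dual complex leads back. *)
Lemma splittingP i y : splitting y <-> exists W, y *: D i = D i *m W *m D i.
Proof.
elim: i => [//|i ->]; split=> -[W yW].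
  have [|V] := @rr_exact_mx i _ (y%:M - D i *m W).
    by rewrite mulmxBl mul_scalar_mx yW subrr.
  move=> yV; exists V; rewrite -mulmxA -yV mulmxBr mul_mx_scalar mulmxA.
  by rewrite (rr_complex rrD) mul0mx subr0.
have [|V] := @rr_ext_ring_mx i _ (y%:M - W *m D i.+1).
  by rewrite mulmxBr mul_mx_scalar yW mulmxA subrr.
move=> yV; exists V; rewrite -yV mulmxBl mul_scalar_mx -mulmxA.
by rewrite (rr_complex rrD) mulmx0 subr0.
Qed.

Lemma splitting_ideal : is_ideal splitting.
Proof.
split=> [|x y [W xW] [V yV]|a x [W xW]].
- by exists 0; rewrite scale0r mulmx0 mul0mx.
- by exists (W + V); rewrite scalerDl mulmxDr mulmxDl xW yV.
- by exists (a *: W); rewrite -scalerA xW -scalemxAr -scalemxAl.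
Qed.

(** The data denied here are those of the overview for the syzygy N generated by the rows of [D i]:
    m = u D_i lies in p F, [z] induces phi : N -> R/p, and phi m is the class of u z. *)
Lemma splitting_residue (p : prime_ideal R) i : splitting `<=` p ->
  ~ forall (u : 'rV_(n i.+1)) (z : 'cV_(n i.+1)),
    in_mx p (u *m D i) -> in_mx p (D i.+1 *m z) -> in_mx p (u *m z).
Proof.
move=> Jp /(residue_exact_split (rr_complex rrD i))[y [W [py yW]]].
by apply: py; apply: Jp; apply/(splittingP i); exists W.
Qed.

Section Syzygy.
Variables (i : nat) (xs : seq R).
Hypothesis xs_i : (size xs <= i)%N.
Hypothesis xs_reg : regular_on [set: R^o] xs.

(** [syz m] consists of the matrices whose rows lie in the [i+1]-st syzygy. *)
Definition syz m : set 'M[R]_(m, n i) := [set V | exists Z, V = Z *m D i].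
Arguments syz : clear implicits.

Lemma syz_submod m : is_submod (syz m).
Proof.
split=> [|a _ _ [Z ->] [Y ->]]; first by exists 0; rewrite mul0mx.
by exists (a *: Z + Y); rewrite mulmxDl scalemxAl.
Qed.

Lemma mulmxr_linear k l m (B : 'M[R]_(l, m)) :
  linear (fun A : 'M[R]_(k, l) => A *m B).
Proof. by move=> a A A'; rewrite mulmxDl scalemxAl. Qed.

Lemma mulmxl_linear k l m (B : 'M[R]_(k, l)) :
  linear (fun A : 'M[R]_(l, m) => B *m A).
Proof. by move=> a A A'; rewrite mulmxDr scalemxAr. Qed.

(** For a high syzygy N in F, N meets (xs) F in (xs) N: [chain_lift] changes [A] by a multiple of
    D_{i+1}, which D_i kills, into a matrix over (xs). *)
Lemma comb_syz m (A : 'M_(m, n i.+1)) :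
  comb [set: 'M_(m, n i)] xs (A *m D i) -> comb (syz m) xs (A *m D i).
Proof.
move=> cA.
have [||||B cB] := @chain_lift R (fun k => 'M[R]_(m, n k))
  (fun k A => A *m D k) xs _ _ _ _ i A xs_i cA.
- by move=> k; apply: mulmxr_linear.
- by move=> k u; rewrite -mulmxA (rr_complex rrD) mulmx0.
- by move=> k u; apply: rr_exact_mx.
- by move=> k; apply: regular_on_mx.
have -> : A *m D i = (A - B *m D i.+1) *m D i.
  by rewrite mulmxBl -mulmxA (rr_complex rrD) mulmx0 subr0.
apply: (comb_linear (f := fun A => A *m D i)) cB; first exact: mulmxr_linear.
by move=> U _; exists U.
Qed.

End Syzygy.
Arguments syz : clear implicits.

Lemma syz_regular i xs m : (size xs <= i)%N -> regular_on [set: R^o] xs ->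
  regular_on (syz i m) xs.
Proof.
move=> + reg; have := regular_on_mx m (n i) reg.
elim: xs reg => [//|x xs IH] [reg _] /= [regm xP] lti.
have lti' := ltnW lti.
split=> [|_ [Z ->] cZ]; first exact: IH.
apply: comb_syz => //; apply: xP => //.
by apply: (comb_subset _ cZ).
Qed.

End RigidResolution.
Arguments syz {R n} D i m _.

Lemma regular_on_cat (R : comPzRingType) (V : lmodType R) (S : set V) xs ys :
  regular_on S (xs ++ ys) -> regular_on S ys.
Proof. by elim: xs => //= x xs IH [/IH]. Qed.

Lemma comb_principal (R : comPzRingType) (y : R) xs r :
  comb [set r : R^o | exists w, r = y * w] xs r ->
  exists2 c, comb [set: R^o] xs c & r = y * c.
Proof.
elim: xs r => [r -> /=|x xs IH r [_ [w ->] /IH[c cc e]]].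
  by exists 0; rewrite ?mulr0.
exists (c + x * w); first by exists w => //=; rewrite addrK.
by rewrite mulrDr -e mulrCA subrK.
Qed.

(** * The trace on endomorphisms of a syzygy, and the contradiction *)

Section Trace.
Variables (R : comPzRingType) (n : nat -> nat).
Variable D : forall i, 'M[R]_(n i.+1, n i).
Hypothesis rrD : rigid_resolution D.

(** An endomorphism of the syzygy, given by [C = C' D = D G], has trace
    [y1^-1 tr (C W1)], because [y1] factors through a free module. *)
Lemma trace_divisible i (y1 y2 : R) (W1 W2 : 'M_(n i, n i.+1))
    (C : 'M_(n i.+1, n i)) C' G :
    y1 *: D i = D i *m W1 *m D i -> y2 *: D i = D i *m W2 *m D i ->
    regular_on [set: R^o] [:: y2; y1] ->
    C = C' *m D i -> C = D i *m G ->
  exists w, \tr (C *m W1) = y1 * w.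
Proof.
move=> y1W y2W [_ reg] CC' CG.
have [//||w _ /eqP] := reg (\tr (C *m W1)); last first.
  by rewrite subr_eq0 => /eqP ->; exists w.
(* The fractions tr (C W1) / y1 and tr (C W2) / y2 agree by cyclicity of the trace, and [y2] is
   regular modulo [y1], so [y1] divides the first numerator. *)
exists (\tr (C *m W2)) => //=; apply/eqP; rewrite subr_eq0; apply/eqP.
rewrite -[LHS]mxtraceZ -[RHS]mxtraceZ.
have -> : y2 *: (C *m W1) = (C *m W2) *m (D i *m W1).
  by rewrite scalemxAl CC' scalemxAr y2W !mulmxA.
have -> : y1 *: (C *m W2) = (D i *m W1) *m (C *m W2).
  by rewrite scalemxAl CG scalemxAl y1W !mulmxA.
exact: mxtrace_mulC.
Qed.

Theorem maximal_regular_sequence_contra (p : prime_ideal R) (s : R) ys y1 y2 :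
    let xs := ys ++ [:: y2; y1] in
    regular_on [set: R^o] xs -> (forall x, x \in xs -> splitting D x) ->
    splitting D `<=` p ->
    prime_set p = [set r | comb [set: R^o] xs (r * s)] ->
  False.
Proof.
move=> xs reg xsJ Jp pE.
have ci := comb_ideal xs.
(* The syzygy is high enough for [chain_lift] and [comb_syz]. *)
pose i := size xs; have xsi : (size xs <= i)%N by [].
apply: (@splitting_residue _ _ _ rrD p i Jp) => u z pu pz.
have [reg1 reg2] : regular_on [set: R^o] [:: y1] /\
    regular_on [set: R^o] [:: y2; y1].
  by have := regular_on_cat reg => /= -[].
have /(splittingP rrD i)[W1 y1W] : splitting D y1.
  by apply: xsJ; rewrite mem_cat !inE eqxx !orbT.
have /(splittingP rrD i)[W2 y2W] : splitting D y2.
  by apply: xsJ; rewrite mem_cat !inE eqxx !orbT.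
(* The entries of m = u D_i lie in p = ((xs) : s), so s m is in (xs) F; correcting s u by a multiple
   of D_{i+1} shows that s m is in (xs) N. *)
have [t ct suD] : exists2 t : 'rV_(n i.+1), comb setT xs t &
    s *: (u *m D i) = t *m D i.
  have cu : comb setT xs ((s *: u) *m D i).
    apply/comb_mx => j k; rewrite -scalemxAl mxE mulrC.
    by have := pu j k; rewrite pE.
  have [||||v cv] := @chain_lift R (fun k => 'rV[R]_(n k))
    (fun k A => A *m D k) xs _ _ _ _ i _ xsi cu.
  - by move=> k; apply: mulmxr_linear.
  - by move=> k w; rewrite -mulmxA (rr_complex rrD) mulmx0.
  - by move=> k w; apply: (rr_exact rrD).
  - by move=> k; apply: regular_on_mx.
  exists (s *: u - v *m D i.+1) => //.
  by rewrite mulmxBl -mulmxA (rr_complex rrD) mulmx0 subr0 scalemxAl.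
(* s z is a cocycle modulo (xs) of the dual complex, which is exact since Ext(M, R) vanishes; [w] is
   the lift psi of s phi. *)
have [w _ cw] : exists2 w : 'cV_(n i), setT w & comb setT xs (s *: z - D i *m w).
  apply: (@cochain_lift R (fun k => 'cV[R]_(n k))
    (fun k => setT) (fun k A => D k *m A) _ _ _ _ 0) => //.
  - by move=> k; apply: mulmxl_linear.
  - by move=> k v; rewrite mulmxA (rr_complex rrD) mul0mx.
  - by move=> k v _ _ /(rr_ext_ring rrD)[w ->]; exists w.
  - by move=> k _; apply: regular_on_mx.
  - apply/comb_mx => j k; rewrite -scalemxAr mxE mulrC.
    by have := pz j k; rewrite pE.
(* [E] is the endomorphism psi(_) m of N, composed with the cover of N by a free module. *)
pose E := D i *m w *m (u *m D i).
have cE : comb (syz D i (n i.+1)) xs E.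
  have -> : E = z *m (t *m D i) - (s *: z - D i *m w) *m (u *m D i).
    by rewrite -suD mulmxBl -scalemxAr -scalemxAl opprB addrCA subrr addr0.
  apply: submodB; first exact/comb_submod/syz_submod.
    apply: (comb_linear (f := fun A => z *m (A *m D i))) ct.
      by move=> a A B; rewrite mulmxDl mulmxDr -scalemxAl -scalemxAr.
    by move=> A _; exists (z *m A); rewrite mulmxA.
  apply: (comb_linear (f := fun A => A *m (u *m D i))) cw.
    exact: mulmxr_linear.
  by move=> A _; exists (A *m u); rewrite mulmxA.
have dE : D i.+1 *m E = 0 by rewrite /E !mulmxA (rr_complex rrD) !mul0mx.
(* The cocycles are the endomorphisms of N; the vanishing of Ext^j(N, N) gives the exactness above
   them that [comb_cocycle] requires. *)
have {}cE : comb [set C | syz D i _ C /\ D i.+1 *m C = 0] xs E.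
  apply: (@comb_cocycle R (fun k => 'M[R]_(n k, n i))
    (fun k => syz D i (n k)) (fun k A => D k *m A) _ _ _ _ i.+1) => //.
  - by move=> k; apply: syz_submod.
  - by move=> k; apply: mulmxl_linear.
  - by move=> k _ [Z ->]; exists (D k *m Z); rewrite mulmxA.
  - by move=> k A; rewrite mulmxA (rr_complex rrD) mul0mx.
  - move=> k _ ik [Z ->]; rewrite mulmxA => /(rr_ext_self rrD ik)[Y ->].
    by exists (Y *m D i); [exists Y|rewrite mulmxA].
  - by move=> k _; apply: syz_regular.
(* y1^-1 tr (E W1) equals psi m = u D_i w, while [cE] puts it in (xs). *)
have trE : \tr (E *m W1) = y1 * (u *m D i *m w) 0 0.
  rewrite /E -mulmxA mxtrace_mulC trace_mx11.
  have -> : u *m D i *m W1 *m (D i *m w) = u *m (D i *m W1 *m D i) *m w.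
    by rewrite !mulmxA.
  by rewrite -y1W -scalemxAr -scalemxAl mxE.
have [c cc tc] : exists2 c, comb [set: R^o] xs c & \tr (E *m W1) = y1 * c.
  apply: comb_principal.
  apply: (comb_linear (f := fun A => \tr (A *m W1) : R^o)) cE.
    by move=> a A B; rewrite mulmxDl -scalemxAl linearP.
  move=> C [[C' CC'] /(rr_ext_ring_mx rrD)[G CG]].
  exact: trace_divisible y1W y2W reg2 CC' CG.
have uDw : (u *m D i *m w) 0 0 = c.
  have [_ /(_ (((u *m D i *m w) 0 0 - c) : R^o))] := reg1.
  move=> /(_ I) h; apply/eqP; rewrite -subr_eq0; apply/eqP; apply: h => /=.
  by rewrite [_ *: _]mulrBr -trE tc subrr.
(* Modulo (xs), s (u z) equals psi m, hence 0; so u z lies in ((xs) : s) = p. *)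
move=> j k; rewrite !ord1 pE /=.
have -> : (u *m z) 0 0 * s = (u *m (s *: z - D i *m w)) 0 0 + c.
  rewrite mulmxBr mulmxA -scalemxAr -uDw.
  rewrite [X in _ = X + _]mxE [X in _ = X + _ + _]mxE [X in _ = _ + X + _]mxE.
  by rewrite subrK mulrC.
case: (ci) => _ cD _; apply: cD => //.
move: (cw) => /(comb_linear (mulmxl_linear u) (S' := setT) (fun _ _ => I)).
by move=> /comb_mx.
Qed.
End Trace.

(** * Localization at a prime ideal *)

Section LocalizationMap.
Variables (R : comPzRingType) (p : prime_ideal R).
Local Notation L := (localization p).

Definition loc_of (r : R) : L := frac r (@prime_proper R p).

Lemma loc_of_zmod : zmod_morphism loc_of.
Proof.
move=> x y; rewrite /loc_of fracN fracD; apply/frac_eq; exists 1.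
  exact: prime_proper.
by ring.
Qed.

Lemma loc_of_monoid : monoid_morphism loc_of.
Proof.
split=> // x y; rewrite /loc_of fracM; apply/frac_eq; exists 1.
  exact: prime_proper.
by ring.
Qed.

HB.instance Definition _ := GRing.isZmodMorphism.Build R L loc_of loc_of_zmod.
HB.instance Definition _ := GRing.isMonoidMorphism.Build R L loc_of loc_of_monoid.

Lemma loc_of_eq0 r : loc_of r = 0 <-> exists2 c, ~ p c & c * r = 0.
Proof.
rewrite -(@frac0 R p) /loc_of frac_eq.
by split=> -[c pc e]; exists c => //; move: e; rewrite mul0r mulr0 mulr1.
Qed.

Lemma loc_of_frac a s (ps : ~ p s) : loc_of s * frac a ps = loc_of a.
Proof.
rewrite /loc_of fracM; apply/frac_eq; exists 1; first exact: prime_proper.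
by ring.
Qed.

Lemma loc_of_unit c : ~ p c -> exists l, l * loc_of c = 1.
Proof. by move=> pc; exists (frac 1 pc); rewrite mulrC loc_of_frac rmorph1. Qed.

Lemma loc_of_reg c (x : L) : ~ p c -> loc_of c * x = 0 -> x = 0.
Proof.
by move=> /loc_of_unit[l lc] cx; rewrite -[x]mul1r -lc -mulrA cx mulr0.
Qed.

Lemma loc_clear (x : L) : exists c a, ~ p c /\ loc_of c * x = loc_of a.
Proof. by elim/fracW: x => a s ps; exists s, a; rewrite loc_of_frac. Qed.

Lemma loc_max_idealP (x : L) :
  loc_max_ideal x <-> exists c a, [/\ ~ p c, p a & loc_of c * x = loc_of a].
Proof.
split=> [[a [s [ps [pa ->]]]]|[c [a [pc pa cx]]]].
  by exists s, a; rewrite loc_of_frac.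
exists a, c, pc; split=> //; apply/eqP; rewrite -subr_eq0; apply/eqP.
by apply: (loc_of_reg pc); rewrite mulrBr cx loc_of_frac subrr.
Qed.

Lemma loc_of_max r : p r -> loc_max_ideal (loc_of r).
Proof.
move=> pr; apply/loc_max_idealP; exists 1, r; split=> //; first exact: prime_proper.
by rewrite rmorph1 mul1r.
Qed.

Lemma loc_of_maxE r : loc_max_ideal (loc_of r) -> p r.
Proof.
move=> /loc_max_idealP[c [a [pc pa]]] /eqP.
rewrite -rmorphM -subr_eq0 -rmorphB => /eqP/loc_of_eq0[d pd e].
have [_ _ pM] := prime_is_ideal p.
have : p (d * (c * r)).
  by move/eqP: e; rewrite mulrBr subr_eq0 => /eqP ->; apply: pM.
by case/prime_mul => // /prime_mul[].
Qed.

Lemma loc_max_is_ideal : is_ideal (@loc_max_ideal R p).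
Proof.
have [p0 pD pM] := prime_is_ideal p; split.
- by rewrite -(rmorph0 loc_of); apply: loc_of_max.
- move=> x y /loc_max_idealP[c [a [pc pa cx]]] /loc_max_idealP[d [b [pd pb dy]]].
  apply/loc_max_idealP; exists (c * d), (d * a + c * b); split.
  + exact: prime_outM.
  + by apply: pD; apply: pM.
  + by rewrite rmorphD !rmorphM /= -cx -dy; ring.
- move=> x y /loc_max_idealP[c [a [pc pa cy]]].
  have [d [b [pd dx]]] := loc_clear x; apply/loc_max_idealP.
  exists (d * c), (b * a); split; [exact: prime_outM|exact: pM|].
  by rewrite !rmorphM /= -cy -dx; ring.
Qed.

Lemma loc_max_unit (x : L) : ~ loc_max_ideal x -> exists y, y * x = 1.
Proof.
have [c [a [pc cx]]] := loc_clear x => nx.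
have pa : ~ p a by move=> pa; apply: nx; apply/loc_max_idealP; exists c, a.
have [l la] := loc_of_unit pa; exists (l * loc_of c).
by rewrite -mulrA cx la.
Qed.

Lemma loc_clear_mx m n (A : 'M[L]_(m, n)) :
  exists c (B : 'M[R]_(m, n)), ~ p c /\ loc_of c *: A = map_mx loc_of B.
Proof.
have /choice[f fP] (ij : 'I_m * 'I_n) : exists ca : R * R,
    ~ p ca.1 /\ loc_of ca.1 * A ij.1 ij.2 = loc_of ca.2.
  by have [c [a h]] := loc_clear (A ij.1 ij.2); exists (c, a).
exists (\prod_ij (f ij).1),
  (\matrix_(i, j) ((\prod_(ij | ij != (i, j)) (f ij).1) * (f (i, j)).2)).
split.
  elim/big_ind: _ => [|x y|ij _]; [exact: prime_proper|exact: prime_outM|].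
  by case: (fP ij).
apply/matrixP => i j; rewrite !mxE rmorphM /= -(fP (i, j)).2 mulrA -rmorphM.
by rewrite (bigD1 (i, j)) //= [(f _).1 * _]mulrC.
Qed.

Lemma loc_of_mx_eq0 m n (B : 'M[R]_(m, n)) : map_mx loc_of B = 0 ->
  exists2 c, ~ p c & c *: B = 0.
Proof.
move=> B0.
have /choice[f fP] (ij : 'I_m * 'I_n) : exists c, ~ p c /\ c * B ij.1 ij.2 = 0.
  have /loc_of_eq0[c pc e] : loc_of (B ij.1 ij.2) = 0.
    by have /matrixP/(_ ij.1 ij.2) := B0; rewrite !mxE.
  by exists c.
exists (\prod_ij f ij).
  elim/big_ind: _ => [|x y|ij _]; [exact: prime_proper|exact: prime_outM|].
  by case: (fP ij).
apply/matrixP => i j; rewrite !mxE (bigD1 (i, j)) //= mulrAC.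
by rewrite (fP (i, j)).2 mul0r.
Qed.

Lemma loc_unscale m n c (A B : 'M[L]_(m, n)) :
  ~ p c -> loc_of c *: A = B -> exists l, A = l *: B.
Proof.
by move=> /loc_of_unit[l lc] <-; exists l; rewrite scalerA lc scale1r.
Qed.

Definition local_depth2 : Prop := exists r1 r2 : L,
  [/\ loc_max_ideal r1, loc_max_ideal r2, forall y, r1 * y = 0 -> y = 0
    & forall y z, r2 * y = r1 * z -> exists w, y = r1 * w].

(** The maximal ideal of R_p kills [s], which is nonzero in R_p, so no element of that ideal is
    regular. *)
Lemma local_depth2_annihilator s :
  prime_set p = [set r | r * s = 0] -> ~ local_depth2.
Proof.
move=> pE [r1 [_ [/loc_max_idealP[c [a [pc pa cr1]]] _ reg _]]].
have /loc_of_eq0[d] : loc_of s = 0.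
  apply: reg; apply: (loc_of_reg pc); rewrite mulrA cr1 -rmorphM.
  by move: pa; rewrite pE /= => ->; rewrite rmorph0.
by rewrite pE.
Qed.

(** From r1 s = y1 z1 and r2 s = y1 z2 follows r2 z1 = r1 z2. Depth two gives z1 = r1 d, hence s =
    y1 d in R_p; clearing denominators puts an element outside p into (y1 : s) = p. *)
Lemma local_depth2_colon s y1 : (forall x, y1 * x = 0 -> x = 0) ->
  prime_set p = [set r | exists w, r * s = y1 * w] -> ~ local_depth2.
Proof.
move=> reg1 pE [r1 [r2 [mr1 mr2 reg reg2]]].
have regL (x : L) : loc_of y1 * x = 0 -> x = 0.
  elim/fracW: x => a t pt /(congr1 ( *%R (loc_of t))).
  rewrite mulrCA loc_of_frac mulr0 -rmorphM => /loc_of_eq0[c pc].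
  rewrite mulrCA => /reg1 ca; apply: (loc_of_reg pt); rewrite loc_of_frac.
  by apply/loc_of_eq0; exists c.
have maxs (r : L) : loc_max_ideal r -> exists z, r * loc_of s = loc_of y1 * z.
  move=> /loc_max_idealP[c [a [pc]]]; rewrite pE => -[w asw] cr.
  have [l lc] := loc_of_unit pc; exists (l * loc_of w).
  rewrite mulrCA -rmorphM -asw rmorphM /= -cr.
  by rewrite !mulrA lc mul1r.
have [z1 e1] := maxs _ mr1; have [z2 e2] := maxs _ mr2.
have e : r2 * z1 = r1 * z2.
  apply/eqP; rewrite -subr_eq0; apply/eqP/regL; rewrite mulrBr.
  by rewrite mulrCA -e1 [X in _ - X]mulrCA -e2 mulrCA subrr.
have [d z1d] := reg2 _ _ e.
have sd : loc_of s = loc_of y1 * d.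
  apply/eqP; rewrite -subr_eq0; apply/eqP/reg; rewrite mulrBr e1 z1d.
  by rewrite mulrCA subrr.
have [c [a [pc cd]]] := loc_clear d.
have : loc_of (c * s - y1 * a) = 0.
  by rewrite rmorphB !rmorphM /= sd -cd mulrCA subrr.
move=> /loc_of_eq0[t pt /eqP]; rewrite mulrBr subr_eq0 => /eqP h.
apply: (prime_outM pt pc); rewrite pE /=; exists (t * a).
by rewrite -mulrA h mulrCA.
Qed.

End LocalizationMap.

Theorem splitting_one (R : comPzRingType) (n : nat -> nat)
    (D : forall i, 'M[R]_(n i.+1, n i)) :
  noetherian R -> rigid_resolution D ->
  (forall p : prime_ideal R, splitting D `<=` p -> local_depth2 p) ->
  splitting D 1.
Proof.
move=> noethR rrD depth2; apply: contrapT => J1.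
have Ji := splitting_ideal D; set J := splitting D in depth2 J1 Ji *.
have proper1 I : I `<=` J -> ~ I 1 by move=> IJ /IJ.
have J0 : [set 0] `<=` J by move=> _ ->; case: Ji.
(* A prime (0 : s) or (y1 : s) containing J would contradict local depth 2, so J contains a regular
   pair [y1], [y2]. *)
have [[y1 Jy1 reg1]|[p [s [_ Jp pE]]]] :=
    nonzerodivisor_or_prime_annihilator noethR (ideal_is0 R) (proper1 _ J0) Ji;
  last first.
  exact: local_depth2_annihilator pE (depth2 p Jp).
have y1J : [set y | exists a, y = a * y1] `<=` J.
  by move=> _ [a ->]; case: Ji => _ _; apply.
have [[y2 Jy2 reg2]|[p [s [_ Jp pE]]]] :=
    nonzerodivisor_or_prime_annihilator noethR (ideal_principal y1) (proper1 _ y1J) Ji;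
  last first.
  apply: (local_depth2_colon (s := s) reg1 _ (depth2 p Jp)); rewrite pE.
  by apply/seteqP; split=> r [w e]; exists w; rewrite /= e mulrC.
pose F I := exists ys, [/\ I = comb [set: R^o] (ys ++ [:: y2; y1]),
  regular_on [set: R^o] (ys ++ [:: y2; y1])
  & forall x, x \in ys ++ [:: y2; y1] -> J x].
have [|| I [ys [IE reg ysJ]] Imax] := noetherian_maximal noethR (F := F).
- by move=> _ [ys [-> _ _]]; apply: comb_ideal.
- exists (comb [set: R^o] [:: y2; y1]), [::]; split=> //.
    split; last first.
      move=> v _ [w _ /= /eqP]; rewrite subr_eq0 => /eqP e.
      have [|a ->] := reg2 v; first by exists w; rewrite [RHS]mulrC; exact: e.
      by exists a => //=; rewrite [_ *: _]mulrC subrr.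
    by split=> // v _ /= /reg1.
  by move=> x; rewrite !inE => /orP[] /eqP ->.
have IJ : I `<=` J by rewrite IE; apply: comb_sub_ideal.
have Ii : is_ideal I by rewrite IE; apply: comb_ideal.
have [[y Jy regy]|[p [s [_ Jp pE]]]] :=
    nonzerodivisor_or_prime_annihilator noethR Ii (proper1 _ IJ) Ji.
  (* A further [y] would lie in I by maximality; being regular modulo I, it would force 1 into I. *)
  apply: (proper1 _ IJ); apply: (regy); rewrite mulr1.
  have /Imax : F (comb [set: R^o] ((y :: ys) ++ [:: y2; y1])).
    exists (y :: ys); split=> //; last first.
      by move=> x; rewrite inE => /orP[/eqP ->|/ysJ].
    by split=> // v _; rewrite -IE; apply: regy.
  by apply; [rewrite IE; by move=> v /(comb_behead y (submodT _))|exact: comb_mem].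
by apply: (maximal_regular_sequence_contra (s := s) rrD reg ysJ Jp); rewrite pE IE.
Qed.

(** * Projective resolutions *)

Section Submodule.
Variables (R : comPzRingType) (V : lmodType R) (S : set V).

Definition submod_pred (SS : is_submod S) : {pred V} := fun v => `[< S v >].

Lemma submod_pred_closed (SS : is_submod S) : submod_closed (submod_pred SS).
Proof.
split=> [|a u v /asboolP Su /asboolP Sv]; apply/asboolP; first by case: SS.
by case: SS => _; apply.
Qed.

HB.instance Definition _ (SS : is_submod S) :=
  GRing.isSubmodClosed.Build R V (submod_pred SS) (submod_pred_closed SS).

Record submodule (SS : is_submod S) := Submodule {
  submodule_val :> V;
  submodule_valP : submodule_val \in submod_pred SS
}.

HB.instance Definition _ (SS : is_submod S) :=
  [isSub for @submodule_val SS].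
HB.instance Definition _ (SS : is_submod S) := [Choice of submodule SS by <:].
HB.instance Definition _ (SS : is_submod S) :=
  [SubChoice_isSubLmodule of submodule SS by <:].

Definition sub_of (SS : is_submod S) v (Sv : S v) : submodule SS :=
  Submodule (asboolT Sv : v \in submod_pred SS).

Lemma submodule_mem (SS : is_submod S) (v : submodule SS) : S (val v).
Proof. by have /asboolP := submodule_valP v. Qed.

Lemma submodule_valL (SS : is_submod S) : linear (val : submodule SS -> V).
Proof. by []. Qed.

End Submodule.

Lemma linear_bundle (R : comPzRingType) (U V : lmodType R) (f : U -> V) :
  linear f -> exists g : {linear U -> V}, forall x, g x = f x.
Proof.
move=> lf; pose g : {linear U -> V} := HB.pack f (GRing.isLinear.Build _ _ _ _ f lf).
by exists g.
Qed.

(** Both maps are corestricted to the image of [d], onto which [d] is surjective. *)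
Lemma projective_lift (R : comPzRingType) (P X Y : lmodType R)
    (d : {linear X -> Y}) (f : P -> Y) : projective P -> linear f ->
  (forall u, exists x, d x = f u) -> exists h : {linear P -> X}, forall u, d (h u) = f u.
Proof.
move=> projP lf df.
pose S : set Y := [set y | exists x, d x = y].
have SS : is_submod S.
  split=> [|a _ _ [x <-] [x' <-]]; first by exists 0; rewrite linear0.
  by exists (a *: x + x'); rewrite linearP.
have Sd x : S (d x) by exists x.
have [|d' d'E] := @linear_bundle R X (submodule SS) (fun x => sub_of SS (Sd x)).
  by move=> a x y; apply: val_inj; rewrite submodule_valL /= linearP.
have [|f' f'E] := @linear_bundle R P (submodule SS) (fun u => sub_of SS (df u)).
  by move=> a x y; apply: val_inj; rewrite submodule_valL /= lf.
have [|h hE] := projP _ _ d' f'.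
  move=> y; have [x xy] := submodule_mem y.
  by exists x; rewrite d'E; apply: val_inj.
by exists h => u; have /(congr1 val) := hE u; rewrite d'E f'E.
Qed.

(** * Transfer of Ext vanishing between resolutions *)

Section Comparison.
Variables (R : comPzRingType) (M : lmodType R) (P Q : projective_resolution M).

Lemma res_dd (T : projective_resolution M) k (x : T k.+2) :
  res_diff T k (res_diff T k.+1 x) = 0.
Proof. by apply/res_exactS; exists x. Qed.

(** One stage of the comparison theorem, with just what the next stage needs: [h], [f] are part of a
    chain map, [g] goes back and preserves cycles, and [t], [s] form a homotopy from the identity to
    g f. *)
Let comparison k := exists (h : {linear P k -> Q k})
    (f : {linear P k.+1 -> Q k.+1}) (g : {linear Q k.+1 -> P k.+1})
    (t : {linear P k -> P k.+1}) (s : {linear P k.+1 -> P k.+2}),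
  [/\ forall x, res_diff Q k (f x) = h (res_diff P k x),
      forall y, res_diff Q k y = 0 -> res_diff P k (g y) = 0
    & forall x, x = g (f x) + (res_diff P k.+1 (s x) + t (res_diff P k x))].

Let comparisonS k : comparison k -> comparison k.+1.
Proof.
move=> [h [f [g [t [s [fh g0 gf]]]]]].
have [||f' f'E] := @projective_lift R _ _ _ (res_diff Q k.+1)
  (f \o res_diff P k.+1) (@res_projective _ _ P k.+2).
- exact: linearP.
- by move=> u; apply/res_exactS => /=; rewrite fh res_dd linear0.
have [||g' g'E] := @projective_lift R _ _ _ (res_diff P k.+1)
  (g \o res_diff Q k.+1) (@res_projective _ _ Q k.+2).
- exact: linearP.
- by move=> u; apply/res_exactS/g0; rewrite res_dd.
have [||s' s'E] := @projective_lift R _ _ _ (res_diff P k.+2)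
  (idfun \- (g' \o f') \- (s \o res_diff P k.+1)) (@res_projective _ _ P k.+2).
- exact: linearP.
- move=> u; apply/res_exactS => /=; rewrite !linearB /= g'E /= f'E /=.
  have := gf (res_diff P k.+1 u); rewrite res_dd linear0 addr0 => {1}->.
  by rewrite addrAC addrK subrr.
exists f, f', g', s, s'; split=> [x|y y0|x]; first exact: f'E.
  by rewrite g'E /= y0 linear0.
by rewrite s'E /= subrK addrC subrK.
Qed.

Let comparison0 : comparison 0.
Proof.
have [||f0 f0E] := @projective_lift R _ _ _ (res_aug Q) (res_aug P)
  (@res_projective _ _ P 0).
- exact: linearP.
- by move=> u; apply: res_aug_surj.
have [||g0 g0E] := @projective_lift R _ _ _ (res_aug P) (res_aug Q)
  (@res_projective _ _ Q 0).
- exact: linearP.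
- by move=> u; apply: res_aug_surj.
have augd (T : projective_resolution M) (x : T 1%N) : res_aug T (res_diff T 0 x) = 0.
  by apply/res_exact0; exists x.
have [||t tE] := @projective_lift R _ _ _ (res_diff P 0)
  (idfun \- (g0 \o f0)) (@res_projective _ _ P 0).
- exact: linearP.
- by move=> u; apply/res_exact0; rewrite /= linearB g0E f0E subrr.
have [||f f'E] := @projective_lift R _ _ _ (res_diff Q 0)
  (f0 \o res_diff P 0) (@res_projective _ _ P 1).
- exact: linearP.
- by move=> u; apply/res_exact0 => /=; rewrite f0E augd.
have [||g g'E] := @projective_lift R _ _ _ (res_diff P 0)
  (g0 \o res_diff Q 0) (@res_projective _ _ Q 1).
- exact: linearP.
- by move=> u; apply/res_exact0 => /=; rewrite g0E augd.
have [||s sE] := @projective_lift R _ _ _ (res_diff P 1)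
  (idfun \- (g \o f) \- (t \o res_diff P 0)) (@res_projective _ _ P 1).
- exact: linearP.
- move=> u; apply/res_exactS => /=; rewrite !linearB /= g'E /= f'E /= tE /=.
  by rewrite subrr.
exists f0, f, g, t, s; split=> [x|y y0|x]; first exact: f'E.
  by rewrite g'E /= y0 linear0.
by rewrite sE /= subrK addrC subrK.
Qed.

(** A cocycle F on P pulls back along [g] to a coboundary G d on Q; the homotopy then gives F = (G h
    + F t) d. *)
Lemma Ext_vanish_comparison (N : lmodType R) i :
  (forall f : {linear Q i.+1 -> N}, (forall x, f (res_diff Q i.+1 x) = 0) ->
    exists g : {linear Q i -> N}, forall x, f x = g (res_diff Q i x)) ->
  (forall x : Ext P N i.+1, x = 0).
Proof.
move=> vanQ; apply/Ext_trivialP => F F0 /=.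
have [h [f [g [t [s [fh g0 gf]]]]]] : comparison i.
  by elim: i {vanQ F F0} => [|i]; [exact: comparison0|exact: comparisonS].
have [|G GE] := vanQ (F \o g).
  move=> x /=; have /res_exactS[z <-] : res_diff P i (g (res_diff Q i.+1 x)) = 0.
    by apply: g0; rewrite res_dd.
  exact: F0.
exists ((G \o h) \+ (F \o t)) => x /=.
by rewrite {1}[x]gf !linearD F0 add0r -fh -GE.
Qed.
End Comparison.

Lemma rV_projective (R : comPzRingType) n : projective 'rV[R]_n.
Proof.
move=> X Y g f surj.
have /choice[x xE] (i : 'I_n) := surj (f (delta_mx 0 i)).
have [|h hE] := @linear_bundle R 'rV_n X (fun u => \sum_i u 0 i *: x i).
  move=> a u v; rewrite scaler_sumr -big_split; apply: eq_bigr => i _ /=.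
  by rewrite !mxE scalerDl scalerA.
exists h => u; rewrite hE linear_sum [in RHS](row_sum_delta u) linear_sum.
by apply: eq_bigr => i _; rewrite !linearZ /= xE.
Qed.

Section FreeResolution.
Variables (R : comPzRingType) (n : nat -> nat).
Variable D : forall i, 'M[R]_(n i.+1, n i).
Variables (M : lmodType R) (e : {linear 'rV[R]_(n 0%N) -> M}).
Hypothesis e_surj : forall x, exists u, e u = x.
Hypothesis e_exact : forall u, e u = 0 <-> exists v, u = v *m D 0.
Hypothesis D_exact : forall i (u : 'rV_(n i.+1)),
  u *m D i = 0 <-> exists v, u = v *m D i.+1.

Definition free_resolution : projective_resolution M.
Proof.
refine (@ProjectiveResolution R M (fun k => 'rV[R]_(n k))
  (fun k => mulmxr (D k)) e (fun k => @rV_projective R (n k)) e_surj _ _).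
- move=> u; rewrite e_exact; split=> -[v]; by exists v.
- move=> k u; rewrite /= D_exact; split=> -[v]; by exists v.
Defined.

(** The two summands of M + R give Ext(M, M) and Ext(M, R); the statement for syzygies follows by
    dimension shifting along the resolution. *)
Lemma rigid_of_Ext :
  (forall i, (0 < i)%N -> Ext_eq0 i M (M * R^o)%type) -> rigid_resolution D.
Proof.
move=> extM.
have DD i : D i.+1 *m D i = 0.
  apply/row_matrixP => j; rewrite row_mul row0; apply/D_exact.
  by exists (delta_mx 0 j); rewrite rowE.
have vanish i (f : 'rV[R]_(n i.+1) -> (M * R^o)%type) : linear f ->
    (forall x, f (x *m D i.+1) = 0) ->
    exists g : {linear 'rV_(n i) -> (M * R^o)%type}, forall x, f x = g (x *m D i).
  move=> /linear_bundle[F FE] F0.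
  have /Ext_trivialP/(_ F)[|g gE] := extM i.+1 isT free_resolution.
    by move=> x; rewrite FE; apply: F0.
  by exists g => x; rewrite -FE gE.
have extR i (v : 'cV_(n i.+1)) : D i.+1 *m v = 0 -> exists w, v = D i *m w.
  move=> Dv; have [||g gE] := vanish i (fun u => (0, (u *m v) 0 0)).
  - move=> a u w; rewrite mulmxDl -scalemxAl !mxE; congr (_, _).
    by rewrite /= scaler0 addr0.
  - by move=> x; rewrite -mulmxA Dv mulmx0 mxE.
  exists (\col_j (g (delta_mx 0 j)).2); apply/matrixP => j k; rewrite !ord1.
  have := gE (delta_mx 0 j); rewrite -!rowE => /(congr1 snd) /=.
  rewrite mxE => ->.
  rewrite [X in g X](row_sum_delta _) linear_sum /= mxE.
  rewrite (big_morph (fun x : M * R^o => x.2) (id1 := 0) (op1 := +%R)) //.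
  by apply: eq_bigr => l _; rewrite linearZ /= !mxE.
have exact_mx i m (A : 'M_(m, n i.+1)) :
    A *m D i = 0 -> exists B, A = B *m D i.+1.
  by move=> AD; apply: row_factor => j; apply/D_exact; rewrite -row_mul AD row0.
have extR_mx i m (A : 'M_(n i.+1, m)) : D i.+1 *m A = 0 -> exists B, A = D i *m B.
  move=> DA; apply: col_factor => j.
  by apply: extR; rewrite colE mulmxA DA mul0mx.
split=> //; first by move=> i u /D_exact.
elim=> [|i IH] k Z ik DZ.
  have [G ZG] : exists G, Z *m D 0 = D k *m G by apply: extR_mx; rewrite mulmxA.
  case: k ik Z DZ G ZG => // k _ Z DZ G ZG.
  have [||g gE] := vanish k (fun u => (e (u *m G), 0)).
  - move=> a u w; rewrite mulmxDl -scalemxAl linearP; congr (_, _).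
    by rewrite /= scaler0 addr0.
  - move=> x; congr (_, _); apply/e_exact; exists (x *m Z).
    by rewrite -!mulmxA ZG.
  have [||Y YE] := @projective_lift R _ _ _ e (fun u => (g u).1) (@rV_projective R (n k)).
  - by move=> a u v; rewrite linearP.
  - by move=> u; apply: e_surj.
  have [B GB] : exists B, G - D k *m lin1_mx Y = B *m D 0.
    apply: row_factor => j; apply/e_exact.
    rewrite linearB linearB /= row_mul mul_rV_lin1 YE.
    by rewrite !rowE -gE /= subrr.
  by exists B; rewrite ZG -mulmxA -GB mulmxBr mulmxA DD mul0mx subr0.
(* Ext(M, R) = 0 extracts a factor D_k, leaving a cocycle [G] with values in the previous syzygy,
   one degree lower. A solution there differs from [G] by some B D_{i+1}, and [B] solves the present
   case. *)
have [G ZG] : exists G, Z *m D i.+1 = D k *m G by apply: extR_mx; rewrite mulmxA.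
case: k ik Z DZ G ZG => // k ik Z DZ G ZG.
have [|Y GY] := IH k G ik; first by rewrite -ZG -mulmxA DD mulmx0.
have [|B GB] := exact_mx i _ (G - D k *m Y).
  by rewrite mulmxBl GY subrr.
by exists B; rewrite ZG -mulmxA -GB mulmxBr !mulmxA DD !mul0mx subr0.
Qed.

(** As D_0 = D_0 W D_0, the map 1 - W D_0 kills the rows of D_0 and descends to a section of [e];
    lifts are then made on the free module. *)
Lemma splitting_projective : splitting D 1 -> projective M.
Proof.
move=> [W]; rewrite scale1r => DW X Y g f surj.
have [k kE] := @rV_projective R (n 0) X Y g (f \o e) surj.
have /choice[r rE] := e_surj.
have kD u v : e u = e v -> k (u *m (1%:M - W *m D 0)) = k (v *m (1%:M - W *m D 0)).
  move=> /eqP; rewrite -subr_eq0 -linearB => /eqP/e_exact[w uvw].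
  apply/eqP; rewrite -subr_eq0 -linearB -mulmxBl uvw mulmxBr mulmx1.
  by rewrite !mulmxA -(mulmxA w) -(mulmxA w) -DW subrr linear0.
have [|h hE] := @linear_bundle R M X (fun x => k (r x *m (1%:M - W *m D 0))).
  move=> a x y; rewrite -linearP scalemxAl -mulmxDl; apply: kD.
  by rewrite linearP !rE.
exists h => x; rewrite hE kE /= mulmxBr mulmx1 linearB /= mulmxA.
have /e_exact -> : exists v, r x *m W *m D 0 = v *m D 0 by exists (r x *m W).
by rewrite subr0 rE.
Qed.
End FreeResolution.

(** Induction on [n]: the first coordinates form a finitely generated ideal, and the elements with
    first coordinate 0 form a submodule of R^n. *)
Lemma noetherian_rV_submod (R : comPzRingType) n (S : set 'rV[R]_n) :
  noetherian R -> is_submod S ->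
  exists m (A : 'M_(m, n)), forall v, S v <-> exists u, v = u *m A.
Proof.
move=> noethR; elim: n S => [|n IH] S SS.
  exists 0%N, 0 => v; rewrite [v]thinmx0.
  by split=> _; [exists 0; rewrite mul0mx|case: SS].
pose I : set R := [set c | exists2 v : 'rV_(1 + n), S v & v 0 0 = c].
have Ii : is_ideal I.
  split=> [|x y [u Su <-] [v Sv <-]|a x [u Su <-]].
  - by exists 0; [case: SS|rewrite mxE].
  - by exists (u + v); [apply: submodD|rewrite mxE].
  - by exists (a *: u); [apply: submodZ|rewrite mxE].
have [s Is] := noethR I Ii.
have /choice[V VP] (k : 'I_(size s)) : exists v : 'rV_(1 + n), S v /\ v 0 0 = s`_k.
  have : I s`_k by rewrite Is; apply/span_ideal_mem/mem_nth.
  by move=> [v Sv v0]; exists v.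
pose S0 : set 'rV[R]_n := [set w | S (row_mx (0 : 'rV_1) w : 'rV_(1 + n))].
have SS0 : is_submod S0.
  split=> [|a u v]; rewrite /S0 /= ?row_mx0; first by case: SS.
  have -> : row_mx 0 (a *: u + v) = a *: row_mx 0 u + row_mx 0 v :> 'rV_(1 + n).
    by rewrite scale_row_mx add_row_mx scaler0 addr0.
  by case: SS => _; apply.
have [m [A AP]] := IH S0 SS0.
pose B : 'M_(size s, 1 + n) := \matrix_k V k.
exists (size s + m)%N, (col_mx B (row_mx (0 : 'M_(m, 1)) A)) => v.
have SB (u : 'rV_(size s)) : S (u *m B).
  rewrite mulmx_sum_row; elim/big_ind: _ => [|x y|k _]; first by case: SS.
    exact: submodD.
  by apply: submodZ => //; rewrite rowK; case: (VP k).
have SA (u : 'rV_m) : S (u *m row_mx (0 : 'M_(m, 1)) A : 'rV_(1 + n)).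
  by rewrite mul_mx_row mulmx0; apply/AP; exists u.
split=> [Sv|[u ->]]; last first.
  by rewrite -[u]hsubmxK mul_row_col; apply: submodD.
have : I ((v : 'rV_(1 + n)) 0 0) by exists v.
rewrite Is => -[c vc]; pose u : 'rV_(size s) := \row_k c k.
have uB : (u *m B) 0 0 = v 0 0.
  by rewrite vc mxE; apply: eq_bigr => k _; rewrite !mxE; case: (VP k) => _ ->.
have [w vw] : exists w : 'rV_n, v - u *m B = row_mx (0 : 'rV_1) w.
  pose x : 'rV_(1 + n) := v - u *m B; exists (rsubmx x).
  rewrite -[LHS]/x -{1}[x]hsubmxK; suff -> : lsubmx x = 0 by [].
  apply/matrixP => i j; rewrite !ord1 !mxE.
  have -> : lshift n 0 = 0 :> 'I_(1 + n) by apply: val_inj.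
  by move: uB; rewrite mxE => ->; rewrite subrr.
have /AP[t wt] : S0 w by rewrite /S0 /= -vw; apply: submodB.
have tA : t *m row_mx (0 : 'M_(m, 1)) A = v - u *m B.
  by rewrite vw wt mul_mx_row mulmx0.
by exists (row_mx u t); rewrite mul_row_col tA addrC subrK.
Qed.

Lemma noetherian_kernel (R : comPzRingType) m n (A : 'M[R]_(m, n)) :
  noetherian R ->
  exists k (B : 'M_(k, m)), forall u : 'rV_m, u *m A = 0 <-> exists v, u = v *m B.
Proof.
move=> noethR; apply: (@noetherian_rV_submod R m [set u | u *m A = 0]) => //.
split=> [|a u v] /=; first by rewrite mul0mx.
by move=> uA vA; rewrite mulmxDl -scalemxAl uA vA scaler0 addr0.
Qed.

Lemma free_resolution_exists (R : comPzRingType) (M : lmodType R) :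
    noetherian R -> finitely_generated M ->
  exists (n : nat -> nat) (D : forall i, 'M[R]_(n i.+1, n i))
    (e : {linear 'rV[R]_(n 0%N) -> M}),
  [/\ forall x, exists u, e u = x,
      forall u, e u = 0 <-> exists v, u = v *m D 0
    & forall i (u : 'rV_(n i.+1)), u *m D i = 0 <-> exists v, u = v *m D i.+1].
Proof.
move=> noethR [n0 [v vM]].
have [|e eE] := @linear_bundle R 'rV_n0 M (fun u => \sum_i u 0 i *: v i).
  move=> a u w; rewrite scaler_sumr -big_split; apply: eq_bigr => i _ /=.
  by rewrite !mxE scalerDl scalerA.
have [|n1 [D0 D0P]] := @noetherian_rV_submod R n0 [set u | e u = 0] noethR.
  split=> [|a u w] /=; first by rewrite linear0.
  by move=> eu ew; rewrite linearP eu ew scaler0 addr0.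
pose T := {mn : nat * nat & 'M[R]_(mn.1, mn.2)}.
pose next (t : T) := cid (noetherian_kernel (projT2 t) noethR).
pose step (t : T) : T :=
  existT (fun mn : nat * nat => 'M[R]_(mn.1, mn.2))
    (sval (next t), (projT1 t).1) (sval (cid (svalP (next t)))).
pose st i := iter i step (existT (fun mn : nat * nat => 'M[R]_(mn.1, mn.2)) (n1, n0) D0).
exists (fun i => (projT1 (st i)).2), (fun i => projT2 (st i)), e; split.
- move=> x; have [c xc] := vM x; exists (\row_i c i); rewrite eE xc.
  by apply: eq_bigr => i _; rewrite mxE.
- exact: D0P.
- by move=> i; apply: (svalP (cid (svalP (next (st i))))).
Qed.

(** The conjecture is applied to the first syzygy, a submodule of [R^(n 0)]. *)
Lemma Auslander_Reiten_splitting (R : comPzRingType) (n : nat -> nat)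
    (D : forall i, 'M[R]_(n i.+1, n i)) :
  rigid_resolution D -> Auslander_Reiten R -> splitting D 1.
Proof.
move=> rrD AR.
pose S : set 'rV[R]_(n 0) := [set v | exists u, v = u *m D 0].
have SS : is_submod S.
  split=> [|a _ _ [u ->] [v ->]]; first by exists 0; rewrite mul0mx.
  by exists (a *: u + v); rewrite mulmxDl scalemxAl.
have SD u : S (u *m D 0) by exists u.
pose M := submodule SS.
have [|e eE] := @linear_bundle R 'rV_(n 1) M (fun u => sub_of SS (SD u)).
  by move=> a u v; apply: val_inj; rewrite submodule_valL /= mulmxDl scalemxAl.
have ve u : val (e u) = u *m D 0 by rewrite eE.
have e_surj x : exists u, e u = x.
  by have [u xu] := submodule_mem x; exists u; apply: val_inj; rewrite ve.
have e_exact u : e u = 0 <-> exists v, u = v *m D 1.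
  split=> [/(congr1 val)|[v ->]]; first by rewrite ve => /(rr_exact rrD).
  by apply: val_inj; rewrite ve -mulmxA (rr_complex rrD) mulmx0.
have D_exact i (u : 'rV_(n i.+2)) :
    u *m D i.+1 = 0 <-> exists v, u = v *m D i.+2.
  split=> [/(rr_exact rrD)//|[v ->]].
  by rewrite -mulmxA (rr_complex rrD) mulmx0.
have projM : projective (M : lmodType R).
  apply: AR => [|[//|j] _ P].
    exists (n 1), (fun i => e (delta_mx 0 i)) => x.
    have [u <-] := e_surj x; exists (fun i => u 0 i).
    by rewrite {1}(row_sum_delta u) linear_sum; apply: eq_bigr => i _; rewrite linearZ.
  (* The resolution shifted by one degree resolves the syzygy. The two components of a cocycle are
     handled by [rr_ext_self] with i = 0 and by [rr_ext_ring]. *)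
  apply: (Ext_vanish_comparison (Q := free_resolution e_surj e_exact D_exact)).
  move=> f f0.
  have [|f1 f1E] := @linear_bundle R 'rV_(n j.+2) 'rV_(n 0) (fun u => val (f u).1).
    by move=> a u v; rewrite linearP.
  have [|f2 f2E] := @linear_bundle R 'rV_(n j.+2) 'rV_1 (fun u => const_mx (f u).2).
    by move=> a u v; rewrite linearP; apply/matrixP => i k; rewrite !mxE.
  have [Z ZE] : exists Z, lin1_mx f1 = Z *m D 0.
    apply: row_factor => i; rewrite rowE mul_rV_lin1 f1E.
    exact: (submodule_mem (f (delta_mx 0 i)).1).
  have [|Y YE] := rr_ext_self rrD (isT : (0 < j.+1)%N) (Z := Z).
    rewrite -mulmxA -ZE; apply/row_matrixP => i.
    by rewrite row_mul mul_rV_lin1 f1E rowE row0 f0.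
  have [|w wE] := rr_ext_ring rrD (v := lin1_mx f2).
    apply/row_matrixP => i; rewrite row_mul mul_rV_lin1 f2E rowE row0 f0.
    by apply/matrixP => ? ?; rewrite !mxE.
  have [|g gE] := @linear_bundle R 'rV_(n j.+1) (M * R^o)%type
      (fun u => (sub_of SS (SD (u *m Y)), (u *m w) 0 0)).
    move=> a u v; congr (_, _); last by rewrite mulmxDl -scalemxAl !mxE.
    by apply: val_inj; rewrite submodule_valL /= mulmxDl -scalemxAl mulmxDl -scalemxAl.
  exists g => x; rewrite gE [LHS]surjective_pairing /=; congr (_, _).
    apply: val_inj; rewrite -f1E -mul_rV_lin1 ZE YE /=.
    by rewrite !mulmxA.
  by rewrite -mulmxA -wE mul_rV_lin1 f2E mxE.
have [//||h hE] := @projective_lift R M _ _ e idfun projM.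
  by move=> x; apply: e_surj.
(* The section [h] of [e] gives H D_0 = D_0 and D_1 H = 0; dual exactness yields H = D_0 W, hence
   D_0 = D_0 W D_0. *)
pose H := lin1_mx (h \o e).
have HD : H *m D 0 = D 0.
  apply/row_matrixP => i; rewrite row_mul !rowE mul_rV_lin1 /= -ve hE.
  by rewrite ve.
have [|W HW] := @rr_ext_ring_mx _ _ _ rrD 0 _ H.
  apply/row_matrixP => i; rewrite row_mul mul_rV_lin1 row0 /=.
  have /e_exact -> : exists v, row i (D 1) = v *m D 1.
    by exists (delta_mx 0 i); rewrite rowE.
  by rewrite linear0.
by exists W; rewrite scale1r -HW HD.
Qed.

(** * Localizing a rigid resolution *)

Section LocalizeResolution.
Variables (R : comPzRingType) (p : prime_ideal R) (n : nat -> nat).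
Variable D : forall i, 'M[R]_(n i.+1, n i).
Hypothesis rrD : rigid_resolution D.
Let DL i : 'M[localization p]_(n i.+1, n i) := map_mx (@loc_of R p) (D i).

Lemma rigid_resolution_localization : rigid_resolution DL.
Proof.
(* An equation satisfied by a matrix over R_p already holds for a numerator over R, after
   multiplication by an element outside p. *)
have clear m k (A : 'M[localization p]_(m, k)) (F : 'M[R]_(m, k) -> Prop) :
  (forall c B, ~ p c -> loc_of p c *: A = map_mx (@loc_of R p) B ->
     exists2 d, ~ p d & F (d *: B)) ->
  exists c B, [/\ ~ p c, F B & loc_of p c *: A = map_mx (@loc_of R p) B].
  move=> h; have [c [B [pc cA]]] := loc_clear_mx A; have [d pd FB] := h c B pc cA.
  exists (d * c), (d *: B); split; [exact: prime_outM|by []|].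
  by rewrite map_mxZ -cA scalerA rmorphM.
split=> [i|i u uD|i v Dv|i k Z ik DZ].
- by rewrite /DL -map_mxM (rr_complex rrD) map_mx0.
- have [|c [B [pc BD cu]]] := clear _ _ u (fun B => B *m D i = 0).
    move=> c B pc cu; have [|d pd dB] := @loc_of_mx_eq0 _ p _ _ (B *m D i).
      by rewrite map_mxM -cu -scalemxAl uD scaler0.
    by exists d => //; rewrite -scalemxAl.
  have [v Bv] := rr_exact rrD BD; have [l ul] := loc_unscale pc cu.
  by exists (l *: map_mx (@loc_of R p) v); rewrite ul Bv map_mxM scalemxAl.
- have [|c [B [pc DB cv]]] := clear _ _ v (fun B => D i.+1 *m B = 0).
    move=> c B pc cv; have [|d pd dB] := @loc_of_mx_eq0 _ p _ _ (D i.+1 *m B).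
      by rewrite map_mxM -cv -scalemxAr Dv scaler0.
    by exists d => //; rewrite -scalemxAr.
  have [w Bw] := rr_ext_ring rrD DB; have [l vl] := loc_unscale pc cv.
  by exists (l *: map_mx (@loc_of R p) w); rewrite vl Bw map_mxM scalemxAr.
- have [|c [B [pc DB cZ]]] := clear _ _ Z (fun B => D k.+1 *m B *m D i = 0).
    move=> c B pc cZ.
    have [|d pd dB] := @loc_of_mx_eq0 _ p _ _ (D k.+1 *m B *m D i).
      by rewrite !map_mxM -cZ -scalemxAr -scalemxAl DZ scaler0.
    by exists d => //; rewrite -scalemxAr -scalemxAl.
  have [Y BY] := rr_ext_self rrD ik DB; have [l Zl] := loc_unscale pc cZ.
  exists (l *: map_mx (@loc_of R p) Y).
  by rewrite Zl -scalemxAl -map_mxM BY !map_mxM -scalemxAr -scalemxAl.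
Qed.

Lemma splitting_localization : splitting DL 1 -> ~ splitting D `<=` p.
Proof.
move=> [W]; rewrite scale1r => DW Jp.
have [c [B [pc cW]]] := loc_clear_mx W.
have [|d pd] := @loc_of_mx_eq0 _ p _ _ (c *: D 0 - D 0 *m B *m D 0).
  rewrite map_mxB map_mxZ !map_mxM -cW -scalemxAr -scalemxAl -scalerBr.
  by rewrite -[X in X - _]/(DL 0) {1}DW subrr scaler0.
move/eqP; rewrite scalerBr subr_eq0 => /eqP e.
apply: (prime_outM pd pc); apply: Jp; exists (d *: B).
by rewrite -scalerA e -scalemxAr -scalemxAl.
Qed.
End LocalizeResolution.

(** * Normal rings *)

(** Over a ring whose maximal ideal is generated by a nonzerodivisor or by zero,
    the complex [D 2], [D 1] stays exact over the residue field. *)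
Lemma principal_max_splitting (R : comPzRingType) (p : prime_ideal R)
    (n : nat -> nat) (D : forall i, 'M[R]_(n i.+1, n i)) (x : localization p) :
  rigid_resolution D -> loc_max_ideal x ->
  (forall y, loc_max_ideal y -> exists z, y = x * z) ->
  x = 0 \/ (forall y, x * y = 0 -> y = 0) ->
  ~ splitting D `<=` p.
Proof.
move=> rrD mx xgen xreg Jp; apply: (splitting_residue rrD (i := 1) Jp).
move=> u z uD Dz i j; rewrite !ord1; apply: loc_of_maxE.
have rrL := rigid_resolution_localization p rrD.
pose f := @loc_of R p; pose uL := map_mx f u; pose zL := map_mx f z.
have Im := loc_max_is_ideal p; have [_ mD mM] := Im.
have [v xv] : exists v, map_mx f (u *m D 1) = x *: v.
  have /choice[v vE] k : exists y, f ((u *m D 1) 0 k) = x * y.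
    by apply/xgen/loc_of_max/uD.
  by exists (\row_k v k); apply/matrixP => k l; rewrite !ord1 !mxE -vE !mxE.
(* For regular [x], x v D_0 = 0 gives v D_0 = 0, so v = w D_1; degree 1 was chosen to have D_0 for
   this test. Then u - x w is a boundary t D_2, and u z = x w z + t D_2 z lies in the maximal
   ideal. *)
have [w wE] : exists w, map_mx f (u *m D 1) = x *: (w *m map_mx f (D 1)).
  case: xreg => [x0|xreg]; first by exists 0; rewrite xv x0 !scale0r.
  have [|w vw] := rr_exact rrL (i := 0) (u := v); last by exists w; rewrite xv vw.
  apply/matrixP => k l; rewrite !mxE; apply: xreg.
  have : x *: (v *m map_mx f (D 0)) = 0.
    by rewrite scalemxAl -xv -map_mxM -mulmxA (rr_complex rrD) mulmx0 map_mx0.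
  by move/matrixP => /(_ k l); rewrite !mxE.
have [|t tE] := rr_exact rrL (i := 1) (u := uL - x *: w).
  by rewrite mulmxBl -map_mxM wE -scalemxAl subrr.
have -> : loc_of p ((u *m z) 0 0) = x * (w *m zL) 0 0 + (t *m map_mx f (D 2 *m z)) 0 0.
  have := congr1 (fun A => (A *m zL) 0 0) tE.
  rewrite /= mulmxBl -scalemxAl -map_mxM -mulmxA -map_mxM !mxE => /eqP.
  by rewrite subr_eq addrC => /eqP.
apply: mD; first by rewrite mulrC; apply: mM.
rewrite mxE; apply: ideal_sum => // k; apply: mM.
by rewrite mxE; apply: loc_of_max.
Qed.

Section NormalLocalization.
Variables (R : comPzRingType) (p : prime_ideal R).
Local Notation f := (@loc_of R p).

(** A normal noetherian local domain is a field, has principal maximal ideal, or has depth at least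
    2; [principal_max_splitting] rules out the first two. *)
Lemma normal_local_depth2 (n : nat -> nat) (D : forall i, 'M[R]_(n i.+1, n i)) :
  noetherian R -> integrally_closed_domain (localization p) ->
  rigid_resolution D -> splitting D `<=` p -> local_depth2 p.
Proof.
move=> noethR [domL closedL] rrD Jp.
have dom0 x y : x * y = 0 :> localization p -> x <> 0 -> y = 0.
  by move=> /domL/orP[/eqP|/eqP].
have [[a pa /eqP fa0]|p0] := pselect (exists2 a, p a & f a <> 0); last first.
  exfalso; apply: (@principal_max_splitting _ p _ D 0 rrD _ _ _ Jp).
  - by case: (loc_max_is_ideal p).
  - move=> y /loc_max_idealP[c [b [pc pb cy]]]; exists 0; rewrite mulr0.
    apply: (loc_of_reg pc); rewrite cy; apply: contrapT => fb.
    by apply: p0; exists b.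
  - by left.
have {}fa0 : f a <> 0 by apply/eqP.
have [p_0 pD pM] := prime_is_ideal p.
(* The contraction to R of the ideal generated by [a] in R_p, so that the dichotomy for ideals of R
   applies. *)
pose I : set R := [set r | exists c b, ~ p c /\ c * r = b * a].
have Ii : is_ideal I.
  split=> [|x y [c [b [pc e]]] [d [g [pd e']]]|x y [c [b [pc e]]]].
  - by exists 1, 0; split; [exact: prime_proper|rewrite mulr0 mul0r].
  - exists (c * d), (d * b + c * g); split; first exact: prime_outM.
    rewrite mulrDl -!mulrA -e -e'; ring.
  - by exists c, (x * b); split=> //; rewrite mulrCA e mulrA.
have IP r : I r <-> exists z, f r = f a * z.
  split=> [[c [b [pc e]]]|[z e]].
    have [l lc] := loc_of_unit pc; exists (l * f b).
    by rewrite mulrCA -rmorphM [a * b]mulrC -e rmorphM mulrA lc mul1r.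
  have [c [b [pc cz]]] := loc_clear z.
  have /loc_of_eq0[t pt /eqP] : f (c * r - b * a) = 0.
    by rewrite rmorphB !rmorphM /= e -cz; apply/eqP; rewrite subr_eq0; apply/eqP; ring.
  rewrite mulrBr subr_eq0 !mulrA => /eqP h.
  by exists (t * c), (t * b); split=> //; apply: prime_outM.
have I1 : ~ I 1.
  by move=> [c [b [pc]]]; rewrite mulr1 => cE; apply: pc; rewrite cE; apply: pM.
have [[y py yreg]|[q [s [Is pq qE]]]] :=
    nonzerodivisor_or_prime_annihilator noethR Ii I1 (prime_is_ideal p).
  exists (f a), (f y); split; [exact: loc_of_max|exact: loc_of_max| |].
    by move=> z az; apply: dom0 az fa0.
  move=> Y Z YZ; have [c [b [pc cY]]] := loc_clear Y.
  have /IP[w bw] : I b.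
    apply/yreg/IP; exists (f c * Z).
    by rewrite rmorphM /= -cY mulrCA YZ mulrCA.
  have [l lc] := loc_of_unit pc; exists (l * w).
  by rewrite -[Y]mul1r -lc -mulrA cY bw mulrCA.
exfalso.
have fs0 : f s <> 0 by move=> fs; apply/Is/IP; exists 0; rewrite fs mulr0.
have mul_s x : loc_max_ideal x -> exists l, x * f s = f a * l.
  move=> /loc_max_idealP[c [b [pc pb cx]]].
  have : I (b * s) by have := pq b pb; rewrite qE.
  move=> /IP[z bs]; have [l lc] := loc_of_unit pc; exists (l * z).
  by rewrite -[x]mul1r -lc -(mulrA l) cx -mulrA -rmorphM /= bs mulrCA.
(* s/a carries the maximal ideal into R_p. If some [x] goes to a unit, then [x] generates the
   maximal ideal; otherwise s/a maps that ideal into itself. *)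
have [[x [l [mx xl nl]]]|all_max] := pselect (exists x l,
    [/\ loc_max_ideal x, x * f s = f a * l & ~ loc_max_ideal l]).
  have [k kl] := loc_max_unit nl.
  apply: (@principal_max_splitting _ p _ D x rrD mx _ _ Jp).
    move=> x' /mul_s[l' xl']; exists (k * l').
    apply/eqP; rewrite -subr_eq0; apply/eqP; apply: (@dom0 (f s)) => //.
    rewrite mulrBr mulrC xl'.
    have -> : f s * (x * (k * l')) = x * f s * (k * l') by ring.
    rewrite xl; have -> : f a * l * (k * l') = f a * ((k * l) * l') by ring.
    by rewrite kl mul1r subrr.
  right=> y xy; apply: (dom0 _ _ xy) => x0; apply: nl.
  have -> : l = 0 by apply: (@dom0 (f a)) => //; rewrite -xl x0 mul0r.
  by case: (loc_max_is_ideal p).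
have [gs gsE] := noethR _ (prime_is_ideal p).
pose g (j : 'I_(size gs)) := f gs`_j.
have pg j : loc_max_ideal (g j).
  apply: loc_of_max; rewrite gsE; exact/span_ideal_mem/mem_nth.
have span_g x : loc_max_ideal x -> exists N : 'I_(size gs) -> localization p,
    x = \sum_i g i * N i.
  move=> /loc_max_idealP[c [b [pc]]]; rewrite gsE => -[N bN] cx.
  have [l lc] := loc_of_unit pc; exists (fun i => l * f (N i)).
  rewrite -[x]mul1r -lc -mulrA cx bN rmorph_sum mulr_sumr.
  by apply: eq_bigr => i _; rewrite rmorphM mulrA mulrC.
have /choice[N NE] j : exists N : 'I_(size gs) -> localization p,
    g j * f s = f a * \sum_i g i * N i.
  have [l gl] := mul_s _ (pg j).
  have /span_g[N lN] : loc_max_ideal l.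
    by apply: contrapT => nl; apply: all_max; exists (g j), l.
  by exists N; rewrite gl lN.
pose Dom : idomainType := domain_of domL.
pose F := {fraction Dom}; pose h (x : localization p) : F := tofrac (x : Dom).
have hM x y : h (x * y) = h x * h y by rewrite /h -tofracM.
have hB x y : h (x - y) = h x - h y by exact: (rmorphB (@tofrac Dom)).
have h_sum (G : 'I_(size gs) -> localization p) : h (\sum_i G i) = \sum_i h (G i).
  exact: (rmorph_sum (@tofrac Dom)).
have h_eq0 x : h x = 0 -> x = 0.
  by move/eqP; rewrite tofrac_eq0 => /eqP.
have ha : h (f a) != 0 by apply/eqP => /h_eq0.
(* The row of generators of the maximal ideal is an eigenvector of [A] for s/a, nonzero because [a]
   is in their span. So s/a is integral, hence in R_p, which puts [s] in I. *)
pose A : 'M[Dom]_(size gs) := \matrix_(i, j) N j i.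
have [] := closedL (h (f s) / h (f a)).
  exists (char_poly A); first exact: char_poly_monic.
  have -> : map_poly (@tofrac Dom) (char_poly A) = char_poly (map_mx (@tofrac Dom) A).
    exact: map_char_poly.
  rewrite -eigenvalue_root_char.
  apply/eigenvalueP; exists (\row_j h (g j)).
    apply/matrixP => i j; rewrite !mxE; apply: (mulfI ha).
    have -> : h (f a) * (h (f s) / h (f a) * h (g j)) = h (g j * f s).
      by rewrite mulrA [h (f a) * _]mulrC divfK // mulrC hM.
    rewrite NE hM h_sum; congr (_ * _).
    by apply: eq_bigr => k _; rewrite !mxE -hM.
  apply/eqP => /matrixP g0; apply: fa0; apply: h_eq0.
  move: pa; rewrite gsE => -[c ->].
  rewrite rmorph_sum h_sum big1 // => j _.
  by have := g0 0 j; rewrite !mxE rmorphM hM => ->; rewrite mulr0.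
move=> d sd; apply/Is/IP; exists (d : localization p).
apply/eqP; rewrite -subr_eq0; apply/eqP/h_eq0.
rewrite hB hM -[h d]/(tofrac (d : Dom)) -sd.
by rewrite mulrC divfK // subrr.
Qed.
End NormalLocalization.

(** An extended integer not at most 1 is at least 2, so (S2) gives a regular sequence of length at
    least 2, whose first two terms are taken. *)
Lemma height_gt1_depth2 (R : comPzRingType) (p : prime_ideal R) :
  serre_S2 R -> ~ (height p <= 1%:E)%E -> local_depth2 p.
Proof.
move=> S2 h1; have h2 : ((2%:Z)%:E <= height p)%E.
  case: (height p) h1 => [z| |]; rewrite ?leey // !lee_fin => /negP.
  by rewrite -ltNge.
have := S2 p; rewrite min_l // => /le_nat_esup[m [s [<- sm [reg _]]] lt].
case: s sm reg lt => [|r1 [|r2 s]] // sm reg _; exists r1, r2; split.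
- by apply: sm; rewrite inE eqxx.
- by apply: sm; rewrite !inE eqxx orbT.
- move=> y r1y; have [//||c] := reg 0%N _ y; last by rewrite big_ord0.
  by exists (fun=> 0); rewrite big_ord0.
- move=> y z yz; have [//||c] := reg 1%N _ y.
    by exists (fun=> z); rewrite /= big_ord1 /= yz mulrC.
  by rewrite /= big_ord1 => ->; exists (c ord0); rewrite mulrC.
Qed.

(** * Assembling the two cases *)

Lemma Auslander_Reiten_of_depth2 (R : comPzRingType) : noetherian R ->
  (forall (n : nat -> nat) (D : forall i, 'M[R]_(n i.+1, n i)) (p : prime_ideal R),
     rigid_resolution D -> splitting D `<=` p -> local_depth2 p) ->
  Auslander_Reiten R.
Proof.
move=> noethR depth2 M fgM extM.
have [n [D [e [e_surj e_exact D_exact]]]] := free_resolution_exists noethR fgM.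
have rrD := rigid_of_Ext e_surj e_exact D_exact extM.
apply: (splitting_projective e_surj e_exact); apply: splitting_one => //.
by move=> p; apply: depth2.
Qed.

Theorem corollary1p2 :
  (forall R : comPzRingType,
     noetherian R -> serre_S2 R ->
     (forall p : prime_ideal R, (height p <= 1%:E)%E ->
        Auslander_Reiten (localization p)) ->
     Auslander_Reiten R) /\
  (forall R : comPzRingType,
     noetherian R -> normal_ring R -> Auslander_Reiten R).
Proof.
split=> R noethR => [S2 AR|normR]; apply: Auslander_Reiten_of_depth2 => //.
  (* In height at most 1 the conjecture for R_p splits the localized resolution, which yields an
     element of the splitting ideal outside p, against [Jp]. *)
  move=> n D p rrD Jp; apply: height_gt1_depth2 => // h1.
  apply: (splitting_localization _ Jp).
  apply: Auslander_Reiten_splitting (AR p h1).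
  exact: rigid_resolution_localization.
move=> n D p; exact: normal_local_depth2.
Qed.
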